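(* Let $\mu$ be a probability measure on $\mathbb{R}^d$ with support $D$, and let $\{V_n\}_{n=0}^\infty\subset L^2_\mu(D)$ be a hierarchical sequence of finite-dimensional subspaces with $N_n=\dim V_n$ and $q^*<\infty$. For each $n$ let $\mathcal{A}_n=\{X_m\}_{m=1}^{M_n}$ with $X_m$ i.i.d. with distribution $\mu$. If $M_n=\lceil 25\,q^*K_\mu(V_n)\log N_n\rceil$, then with probability $1$, $\{\mathcal{A}_n\}_{n=0}^\infty$ forms an asymptotic WAM for $\{V_n\}_{n=0}^\infty$ with exponents $a=q^*+\tau$ and $b=\frac{q^*}{2}+\tau$, for any $\tau>0$.
   Context: Functions are complex-valued and defined pointwise on $D=\operatorname{supp}\mu$. Hierarchical means $V_n\subset V_{n+1}$ and $\dim V_n<\dim V_{n+1}$, with $N_n\ge1$. For an $N$-dimensional $V\subset L^2_\mu(D)$ with orthonormal basis $v_1,\dots,v_N$, $K_\mu(V)=\sup_{x\in D}\sum_{i=1}^N|v_i(x)|^2$ (independent of the basis); $K_\mu(V_n)<\infty$ is assumed for all $n$. $q^*=\limsup_{n\to\infty}\frac{\log K_\mu(V_n)}{\log N_n}$. A sequence of finite sets $\mathcal{A}_n\subset D$ is an asymptotic weakly admissible mesh (asymptotic WAM) for $\{V_n\}$ with exponents $(a,b)$ if there are $N\in\mathbb{N}$ and finite constants $k_a,k_b$ such that for all $n\ge N$: $\sup_{x\in D}|v(x)|\le k_bN_n^b\max_{x\in\mathcal{A}_n}|v(x)|$ for all $v\in V_n$, and $|\mathcal{A}_n|\le k_aN_n^a$.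 (Here $N$, $k_a$, $k_b$ may depend on $\tau$ and on the realization of the samples.) *)

(* Defs.v *)
From HB Require Import structures.
From mathcomp Require Import all_boot all_order all_algebra finmap.
From mathcomp Require Import all_classical all_reals all_analysis.
From mathcomp Require Import complex.

Set Implicit Arguments.
Unset Strict Implicit.
Unset Printing Implicit Defensive.

Import Order.TTheory GRing.Theory Num.Theory.
Import numFieldNormedType.Exports.
Import ComplexField.

Local Open Scope classical_set_scope.
Local Open Scope complex_scope.
Local Open Scope ring_scope.

(* R^d (row vectors) with its Borel sigma-algebra. *)
Definition borelRd (R : realType) (d : nat) :=
  g_sigma_algebraType (@open 'rV[R]_d).

Section L2.
Context {R : realType} {d : nat}.
Variable mu : probability (borelRd R d) R.

Definition supp : set (borelRd R d) :=
  [set x | forall U : set 'rV[R]_d, open U -> U x -> (0 < mu U)%E].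

(* A complex-valued function on supp mu is represented by any function on R^d
   extending it; the values off supp mu play no role. *)
Local Notation fct := (borelRd R d -> R[i]).

Definition in_L2 (v : fct) : Prop :=
  [/\ measurable_fun supp (fun x => complex.Re (v x)),
      measurable_fun supp (fun x => complex.Im (v x)) &
      (\int[mu]_(x in supp) (Normc.normc (v x) ^+ 2)%:E < +oo)%E].

Definition inner (u v : fct) : R[i] :=
  Rintegral mu supp (fun x => complex.Re (u x * (v x)^*)) +i*
  Rintegral mu supp (fun x => complex.Im (u x * (v x)^*)).

Definition lincomb (N : nat) (b : 'I_N -> fct) (c : 'I_N -> R[i]) : fct :=
  fun x => \sum_(i < N) c i * b i x.

Definition spanned_by (V : set fct) (N : nat) (b : 'I_N -> fct) : Prop :=
  V = range (lincomb b).

(* Linear independence in L^2_mu, where functions equal almost everywhere are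
   identified. *)
Definition lin_indep (N : nat) (b : 'I_N -> fct) : Prop :=
  forall c : 'I_N -> R[i],
    {ae mu, forall x, supp x -> lincomb b c x = 0} -> forall i, c i = 0.

Definition L2_subspace_of_dim (V : set fct) (N : nat) : Prop :=
  (forall v, V v -> in_L2 v) /\
  exists b : 'I_N -> fct, spanned_by V b /\ lin_indep b.

Definition orthonormal_basis (V : set fct) (N : nat) (b : 'I_N -> fct) : Prop :=
  spanned_by V b /\ forall i j, inner (b i) (b j) = (i == j)%:R.

(* The value does not depend on the orthonormal basis [b] that is picked; 0 is
   a dummy value, for when [V] has no orthonormal basis with [N] elements. *)
Definition Kmu (V : set fct) (N : nat) : \bar R :=
  xget 0%E [set k | exists2 b : 'I_N -> fct, orthonormal_basis V b &
    k = ereal_sup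
      [set (\sum_(i < N) Normc.normc (b i x) ^+ 2)%:E | x in supp]].

(* For N n = 1 the quotient is 0 in place of an undefined expression; this
   happens for at most one n when N is increasing. *)
Definition qstar (V : nat -> set fct) (N : nat -> nat) : \bar R :=
  limn_esup (fun n => (ln (fine (Kmu (V n) (N n))) / ln (N n)%:R)%:E).

Definition asymptotic_WAM (V : nat -> set fct) (N : nat -> nat)
    (A : nat -> {fset 'rV[R]_d}) (a b : R) : Prop :=
  (forall n x, x \in A n -> supp x) /\
  exists (n0 : nat) (ka kb : R), forall n, (n0 <= n)%N ->
    (forall v, V n v ->
      (ereal_sup [set (Normc.normc (v x))%:E | x in supp] <=
       (kb * (N n)%:R `^ b *
          \big[Order.max/0]_(x <- A n) Normc.normc (v x))%:E)%E) /\
    (#|` A n|)%:R <= ka * (N n)%:R `^ a.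

Definition iid_sample (d' : measure_display) (Omega : measurableType d')
    (P : probability Omega R) (M : nat)
    (X : 'I_M -> Omega -> borelRd R d) : Prop :=
  [/\ forall m, measurable_fun setT (X m),
      forall m (B : set (borelRd R d)), measurable B ->
        P (X m @^-1` B) = mu B &
      forall (J : {set 'I_M}) (B : 'I_M -> set (borelRd R d)),
        (forall m, measurable (B m)) ->
        P (\bigcap_(m in [set` J]) (X m @^-1` B m)) =
        (\prod_(m in J) P (X m @^-1` B m))%E].

End L2.

Definition sample_set (R : realType) (d : nat) (Omega : Type) (M : nat)
    (X : 'I_M -> Omega -> borelRd R d) (w : Omega) : {fset 'rV[R]_d} :=
  [fset (X m w : 'rV[R]_d) | m in 'I_M]%fset.

(* Main.v *)
(** Fix [n], write [N = N_n], [K = K_mu(V_n)], [M = M_n], let [u(x)] collect the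
    (conjugated) values at [x] of an orthonormal basis attaining [K], and put
    [H = 1 - eta * \sum_j u(X_j) u(X_j)^*] with [eta = 1/(4MK)], so that
    [3/4 <= H <= 1].  A matrix Chernoff bound follows without any matrix
    exponential.  Since [tr H^(p+1) = tr H^p - eta \sum_j u_j^* H^p u_j], one
    compares [H] with the matrix [H_j] from which the [j]-th sample is left out:
    telescoping [H_j^p - H^p] and Chebyshev's sum inequality for the spectral
    measure of [u_j] give [u_j^* H^p u_j >= 2/3 u_j^* H_j^p u_j] for [p <= M].
    Independence and [E u u^* = 1] turn the expectation of the latter into
    [E tr H_j^p >= E tr H^p].  Hence [E tr H^M <= N (1 - 1/(6K))^M], and by
    Markov's inequality the sampled Gram matrix is at least [M/6] outside an event
    of probability at most [N (1 - 1/(8K))^M <= N^(1 - 25/8) <= (n+1)^-2].  By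
    Borel-Cantelli, almost surely [sup |v|^2 <= 6 K max |v|^2] for all large [n],
    and [K <= N^(q + eps)] eventually, for every [eps > 0]. *)

Require Import Defs.
From HB Require Import structures.
From mathcomp Require Import all_boot all_order all_algebra finmap.
From mathcomp Require Import all_classical all_reals all_analysis.
From mathcomp Require Import complex.
From mathcomp Require Import measurable_realfun ring lra.

Set Implicit Arguments.
Unset Strict Implicit.
Unset Printing Implicit Defensive.

Import Order.TTheory GRing.Theory Num.Theory.
Import numFieldNormedType.Exports.

Local Open Scope classical_set_scope.
Local Open Scope ring_scope.
Local Open Scope sesquilinear_scope.

(** * Hermitian forms and powers of positive matrices *)

Section HermitianForms.
Variables (C : numClosedFieldType) (n : nat).
Implicit Types (A B P : 'M[C]_n) (u v : 'cV[C]_n).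

Definition qform A v : C := (v ^t* *m A *m v) 0 0.

Lemma qformB A B v : qform (A - B) v = qform A v - qform B v.
Proof. by rewrite /qform mulmxBr mulmxBl !mxE. Qed.

Lemma qformZ (a : C) A v : qform (a *: A) v = a * qform A v.
Proof. by rewrite /qform -scalemxAr -scalemxAl mxE. Qed.

Lemma qform_sum (I : finType) (p : pred I) (A : I -> 'M[C]_n) v :
  qform (\sum_(i | p i) A i) v = \sum_(i | p i) qform (A i) v.
Proof. by rewrite /qform mulmx_sumr mulmx_suml summxE. Qed.

Lemma qform1 v : qform 1 v = \sum_i `|v i 0| ^+ 2.
Proof.
rewrite /qform mulmx1 mxE; apply: eq_bigr => i _.
by rewrite !mxE mulrC -normCK.
Qed.

Lemma qform1_ge0 v : 0 <= qform 1 v.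
Proof. by rewrite qform1 sumr_ge0 // => i _; rewrite exprn_ge0. Qed.

Lemma qform_entries A v :
  qform A v = \sum_i \sum_j (v i 0)^* * v j 0 * A i j.
Proof.
rewrite /qform mxE exchange_big /=; apply: eq_bigr => j _.
rewrite mxE mulr_suml; apply: eq_bigr => i _.
by rewrite !mxE mulrAC.
Qed.

Lemma qform_rank1 u v : qform (u *m u ^t*) v = `|(u ^t* *m v) 0 0| ^+ 2.
Proof.
rewrite /qform mulmxA -mulmxA mxE big_ord1 normCK mulrC; congr (_ * _).
by rewrite !mxE rmorph_sum; apply: eq_bigr => i _; rewrite !mxE rmorphM /= conjCK mulrC.
Qed.

Definition hermitian A := A ^t* = A.

(** Unitary diagonalisation of [A], kept only as formulas for the forms and traces of its powers.
    The last clause exhibits each eigenvalue as the value of the form at a unit vector, so that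
    bounds on [qform A] pass to the eigenvalues. *)
Lemma spectral_form A : hermitian A ->
  exists (P : 'M[C]_n) (d : 'I_n -> C), [/\ P \is unitarymx,
    forall k v, qform (A ^+ k) v = \sum_i d i ^+ k * `|(P *m v) i 0| ^+ 2,
    forall k, \tr (A ^+ k) = \sum_i d i ^+ k &
    forall i, d i = qform A (P ^t* *m delta_mx i 0) /\
       qform 1 (P ^t* *m delta_mx i 0) = 1].
Proof.
move=> hA.
have An : A \is normalmx by apply/normalmxP; rewrite hA.
have /orthomx_spectralP := An.
set P := spectralmx A; set s := spectral_diag A.
have Pu : P \is unitarymx := spectral_unitarymx A.
rewrite invmx_unitary // => AE.
have PPt : P *m P ^t* = 1%:M by apply/unitarymxP.
have PtP : P ^t* *m P = 1%:M by rewrite -invmx_unitary // mulVmx // unitarymx_unit.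
have AkE k : A ^+ k = P ^t* *m diag_mx (\row_i s 0 i ^+ k) *m P.
  elim: k => [|k IH].
    rewrite expr0 (_ : diag_mx _ = 1%:M) ?mulmx1 ?PtP //.
    by apply/matrixP => i j; rewrite !mxE expr0.
  rewrite exprS IH [X in X * _]AE -mulmxE !mulmxA.
  rewrite -(mulmxA _ P) PPt mulmx1.
  rewrite -(mulmxA (P ^t*) (diag_mx s)) mulmx_diag.
  by congr (_ *m diag_mx _ *m _); apply/rowP => i; rewrite !mxE exprS.
exists P, (fun i => s 0 i).
have kform k v : qform (A ^+ k) v = \sum_i s 0 i ^+ k * `|(P *m v) i 0| ^+ 2.
  rewrite AkE /qform !mulmxA -(mulmxA _ P v).
  have -> : v ^t* *m P ^t* = (P *m v) ^t* by rewrite trmx_mul map_mxM.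
  move: (P *m v) => w; rewrite mul_mx_diag mxE; apply: eq_bigr => i _.
  by rewrite !mxE mulrAC mulrC normCK [w i 0 * _]mulrC.
have Pd i : P *m (P ^t* *m delta_mx i 0) = (delta_mx i 0 : 'cV[C]_n).
  by rewrite mulmxA PPt mul1mx.
have sumd k i :
    \sum_j s 0 j ^+ k * `|(P *m (P ^t* *m delta_mx i (0 : 'I_1))) j 0| ^+ 2 = s 0 i ^+ k.
  rewrite Pd (bigD1 i) //= mxE !eqxx normr1 expr1n mulr1 big1 ?addr0 // => j ji.
  by rewrite mxE (negbTE ji) normr0 expr0n mulr0.
split=> //.
- move=> k; rewrite AkE mxtrace_mulC mulmxA PPt mul1mx mxtrace_diag.
  by apply: eq_bigr => i _; rewrite mxE.
- move=> i; split; first by rewrite -[A]expr1 kform sumd.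
  by rewrite -[1](expr0 A) kform sumd.
Qed.


(** Chebyshev's sum inequality. Symmetrising the double sum turns twice the difference of the sides
    into the sum of [w i * w j * (d i ^+ r - d j ^+ r) * (d i ^+ s - d j ^+ s)], where the two
    differences have the same sign. *)
Lemma chebyshev_moments (I : finType) (d w : I -> C) r s :
  (forall i, 0 <= d i) -> (forall i, 0 <= w i) ->
  (\sum_i d i ^+ r * w i) * (\sum_i d i ^+ s * w i) <=
  (\sum_i w i) * (\sum_i d i ^+ (r + s) * w i).
Proof.
move=> d0 w0; rewrite -subr_ge0 !big_distrlr /= -sumrB.
under eq_bigr do rewrite -sumrB.
set T := fun i j => w i * (d j ^+ (r + s) * w j) - d i ^+ r * w i * (d j ^+ s * w j).
suff T2 : 0 <= (\sum_i \sum_j T i j) *+ 2 by rewrite pmulrn_lge0 in T2.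
rewrite mulr2n [X in _ + X]exchange_big -big_split sumr_ge0 //= => i _.
rewrite -big_split sumr_ge0 //= => j _.
have -> : T i j + T j i =
    w i * w j * ((d i ^+ r - d j ^+ r) * (d i ^+ s - d j ^+ s)).
  by rewrite /T !exprD; ring.
apply: mulr_ge0; first exact: mulr_ge0.
have /orP[dij|dij] : (d i <= d j) || (d j <= d i) by apply: ger_leVge.
  by apply: mulr_le0; rewrite subr_le0 lerXn2r // nnegrE.
by rewrite mulr_ge0 // subr_ge0 lerXn2r // nnegrE.
Qed.

Definition psd A := hermitian A /\ forall v, 0 <= qform A v.

Lemma psdX_ge0 A k v : psd A -> 0 <= qform (A ^+ k) v.
Proof.
move=> [hA A0]; have [P [d [_ -> _ dE]]] := spectral_form hA.
rewrite sumr_ge0 // => i _; have [-> _] := dE i.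
by rewrite mulr_ge0 ?exprn_ge0.
Qed.

(** The numbers [qform (A ^+ k) v] are the moments of the spectral measure of [v], which puts mass
    [|(P v)_i|^2] at the eigenvalue [d i]; Chebyshev's inequality is applied to this measure. *)
Lemma qform_chebyshev A r s v : psd A ->
  qform (A ^+ r) v * qform (A ^+ s) v <= qform 1 v * qform (A ^+ (r + s)) v.
Proof.
move=> [hA A0]; have [P [d [_ kE _ dE]]] := spectral_form hA.
have -> : qform 1 v = \sum_i `|(P *m v) i 0| ^+ 2.
  by rewrite -(expr0 A) kE; apply: eq_bigr => i _; rewrite expr0 mul1r.
rewrite !kE.
apply: chebyshev_moments => i; last by rewrite exprn_ge0.
by have [-> _] := dE i.
Qed.

(** Jensen's inequality for the p-th power, by induction from the Chebyshev inequality with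
    exponents 1 and [p]. *)
Lemma qform_power_mean A p v : psd A -> qform 1 v = 1 ->
  qform A v ^+ p <= qform (A ^+ p) v.
Proof.
move=> pA v1; elim: p => [|p IH]; first by rewrite !expr0 v1.
have A0 := pA.2 v; rewrite exprS (le_trans (ler_wpM2l A0 IH)) //.
by have := qform_chebyshev 1 p v pA; rewrite expr1 v1 mul1r.
Qed.

(* Peierls' argument: test [A ^+ p] on an orthonormal eigenbasis of [B]. *)
Lemma mxtraceX_mono A B p : psd B -> psd A ->
  (forall v, qform B v <= qform A v) -> \tr (B ^+ p) <= \tr (A ^+ p).
Proof.
move=> [hB B0] pA BA; have [P [d [Pu _ trE dE]]] := spectral_form hB.
have PtP : P ^t* *m P = 1%:M by rewrite -invmx_unitary // mulVmx // unitarymx_unit.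
(* The trace is invariant under unitary change of basis; the vectors [P ^t* *m delta_mx i 0] are the
   eigenbasis of [B]. *)
have -> : \tr (A ^+ p) = \sum_i qform (A ^+ p) (P ^t* *m delta_mx i 0).
  rewrite -[X in \tr X]mulmx1 -PtP mulmxA mxtrace_mulC !mulmxA.
  apply: eq_bigr => i _; rewrite /qform trmx_mul map_mxM trmxCK.
  have -> : (delta_mx i 0 : 'cV[C]_n) ^t* = delta_mx 0 i.
    by apply/matrixP => j k; rewrite !mxE conjC_nat andbC.
  rewrite !mulmxA -2!(mulmxA (delta_mx _ _)).
  by move: (P *m _ *m _) => X; rewrite -colE -rowE !mxE.
rewrite trE ler_sum // => i _; have [-> v1] := dE i.
apply: le_trans (qform_power_mean p pA v1).
by rewrite lerXn2r // nnegrE // ?(le_trans _ (BA _)).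
Qed.

Lemma qformXS_ge A (a : C) p v : psd A -> 0 <= a ->
  (forall u, a * qform 1 u <= qform A u) ->
  a * qform (A ^+ p) v <= qform (A ^+ p.+1) v.
Proof.
move=> [hA A0] a0 aA; have [P [d [_ kE _ dE]]] := spectral_form hA.
rewrite !kE mulr_sumr ler_sum // => i _; have [di v1] := dE i.
have ad : a <= d i by rewrite di (le_trans _ (aA _)) // v1 mulr1.
rewrite mulrA (exprS (d i)) ler_wpM2r ?exprn_ge0 // ler_wpM2r // exprn_ge0 //.
by rewrite di.
Qed.

(** The p-th power of each eigenvalue is at most the trace of [A ^+ p], the other terms being
    nonnegative. So a scalar bound on this trace controls the whole form. *)
Lemma qform_le_of_mxtraceX A (t : C) p v : psd A -> 0 <= t ->
  \tr (A ^+ p) < t ^+ p -> qform A v <= t * qform 1 v.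
Proof.
move=> [hA A0] t0; have [P [d [_ kE trE dE]]] := spectral_form hA.
have d0 i : 0 <= d i by have [-> _] := dE i.
rewrite trE -[A]expr1 -[1](expr0 A) !kE mulr_sumr => trlt.
rewrite ler_sum // => i _; rewrite expr0 mul1r expr1 ler_wpM2r ?exprn_ge0 //.
have dt : d i ^+ p < t ^+ p.
  apply: le_lt_trans trlt; rewrite (bigD1 i) //= lerDl sumr_ge0 // => j _.
  by rewrite exprn_ge0.
have /orP[//|td] : (d i <= t) || (t <= d i) by apply: ger_leVge.
by move: (lt_le_trans dt (lerXn2r p t0 (d0 i) td)); rewrite ltxx.
Qed.

Lemma subXX_sum A B p :
  A ^+ p - B ^+ p = \sum_(i < p) A ^+ i * (A - B) * B ^+ (p.-1 - i).
Proof.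
elim: p => [|p IH]; first by rewrite big_ord0 subrr.
rewrite big_ord_recl /= subn0 expr0 mul1r.
have -> : \sum_(i < p) A ^+ lift ord0 i * (A - B) * B ^+ (p - lift ord0 i)%N
  = A * (A ^+ p - B ^+ p).
  rewrite IH mulr_sumr; apply: eq_bigr => i _.
  by rewrite /= !mulrA -exprS; congr (_ * _ ^+ _); case: p i {IH} => [[]//|p] i; rewrite subSS.
by rewrite mulrBr mulrBl -!exprS [RHS]addrC addrA subrK.
Qed.

(** Here [A] is the matrix with one sample left out and [B] the full one. With [a i], [b i] the
    moments of [u] under them, the loss [a p - b p] is at most [eta * p * K * a (p-1)], hence at
    most [1/4 * 4/3 * a p = a p / 3]. *)
Lemma rank_one_power_lower A (eta K : C) u p : psd A ->
  psd (A - eta *: (u *m u ^t*)) ->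
  (forall v, 3%:R / 4%:R * qform 1 v <= qform A v) ->
  0 <= eta -> qform 1 u <= K -> eta * K * p%:R <= 4%:R^-1 ->
  2%:R / 3%:R * qform (A ^+ p) u <=
    qform ((A - eta *: (u *m u ^t*)) ^+ p) u.
Proof.
set B := A - _ => pA pB A34 eta0 uK epK.
pose a i := qform (A ^+ i) u; pose b i := qform (B ^+ i) u.
have a0 i : 0 <= a i by apply: psdX_ge0.
have b0 i : 0 <= b i by apply: psdX_ge0.
(* In the telescoping sum the middle factor [A - B] is [eta] times the rank-one matrix of [u], so
   each term splits into a product of two moments. *)
have abE k : a k - b k = eta * \sum_(i < k) a i * b (k.-1 - i)%N.
  rewrite /a /b -qformB subXX_sum qform_sum mulr_sumr; apply: eq_bigr => i _.
  have -> : A - B = eta *: (u *m u ^t*) by rewrite /B opprB addrCA subrr addr0.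
  rewrite -!mulmxE -scalemxAr -scalemxAl qformZ; congr (_ * _).
  rewrite /qform !mulmxA -2!(mulmxA (u ^t* *m A ^+ i *m u)).
  by rewrite [LHS]mxE big_ord1.
have ba k : b k <= a k.
  rewrite -subr_ge0 abE mulr_ge0 // sumr_ge0 // => i _.
  by rewrite mulr_ge0.
have K0 : 0 <= K by apply: le_trans (qform1_ge0 u) uK.
suff ab3 : a p - b p <= a p / 3%:R.
  rewrite -[qform (A ^+ p) u]/(a p) -[qform (B ^+ p) u]/(b p) -subr_ge0.
  rewrite -subr_ge0 in ab3; apply: le_trans ab3 _.
  by rewrite [X in _ <= X](_ : _ = a p / 3%:R - (a p - b p)) //; field.
rewrite abE; case: p epK => [|p] epK.
  by rewrite big_ord0 mulr0 divr_ge0.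
(* Each [b] is replaced by the larger [a]; Chebyshev then bounds [a i * a (p - i)] by
   [qform 1 u * a p]. *)
have step : \sum_(i < p.+1) a i * b (p.+1.-1 - i)%N <= p.+1%:R * (K * a p).
  rewrite -[p.+1 in X in _ <= X]card_ord -sum1_card natr_sum mulr_suml ler_sum //.
  move=> i _; rewrite mul1r (le_trans (ler_wpM2l (a0 _) (ba _))) //.
  apply: (le_trans (qform_chebyshev i (p - i) u pA)).
  have ip : (i <= p)%N by rewrite -ltnS.
  rewrite (subnKC ip) -/(a p).
  exact: ler_wpM2r.
apply: (le_trans (ler_wpM2l eta0 step)).
(* The lower bound [3/4] on the spectrum of [A] recovers the power lost in the telescoping. *)
have ap : a p <= 4%:R / 3%:R * a p.+1.
  have := qformXS_ge p u pA _ A34; rewrite divr_ge0 // => /(_ isT).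
  rewrite -/(a p) -/(a p.+1) => /(ler_wpM2l (_ : 0 <= 4%:R / 3%:R)).
  rewrite divr_ge0 // => /(_ isT); apply: le_trans.
  by rewrite [X in _ <= X](_ : _ = a p) //; field.
rewrite (_ : eta * _ = eta * K * p.+1%:R * a p); last by ring.
apply: (le_trans (ler_wpM2r (a0 _) epK)).
apply: (le_trans (ler_wpM2l (_ : 0 <= 4%:R^-1) ap)); first by rewrite invr_ge0.
by rewrite [X in X <= _](_ : _ = a p.+1 / 3%:R) //; field.
Qed.

End HermitianForms.

(** * Expectations of complex-valued functions *)

Section BoundedReal.
Context (R : realType).

Lemma bounded_integrable d (T : measurableType d)
    (mu : {measure set T -> \bar R}) (f : T -> R) (B : R) :
  (mu setT < +oo)%E -> measurable_fun setT f -> (forall x, `|f x| <= B) ->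
  mu.-integrable setT (EFin \o f).
Proof.
move=> mufin mf fB; apply: measurable_bounded_integrable => //.
by exists B; split; [exact: num_real|move=> y By x _; exact: le_trans (fB x) (ltW By)].
Qed.

Lemma probability_lty d (T : measurableType d) (P : probability T R) :
  (P setT < +oo)%E.
Proof. by rewrite probability_setT ltry. Qed.

(** Independence makes the law of the pair a product measure, and Fubini's theorem factors the
    integral; boundedness supplies every integrability condition. *)
Lemma Rintegral_indep d d1 d2 (T : measurableType d) (T1 : measurableType d1)
    (T2 : measurableType d2) (P : probability T R) (X : T -> T1) (Y : T -> T2)
    (f : T1 -> R) (g : T2 -> R) (B : R) :
  measurable_fun setT X -> measurable_fun setT Y ->
  (forall A B, measurable A -> measurable B ->
     P (X @^-1` A `&` Y @^-1` B) = P (X @^-1` A) * P (Y @^-1` B))%E ->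
  measurable_fun setT f -> (forall x, `|f x| <= B) ->
  measurable_fun setT g -> (forall x, `|g x| <= B) ->
  Rintegral P setT (fun w => f (X w) * g (Y w)) =
  Rintegral P setT (f \o X) * Rintegral P setT (g \o Y).
Proof.
move=> mX mY ind mf fB mg gB.
pose X' : {mfun T >-> T1} := HB.pack X (isMeasurableFun.Build _ _ _ _ X mX).
pose Y' : {mfun T >-> T2} := HB.pack Y (isMeasurableFun.Build _ _ _ _ Y mY).
have mXY : measurable_fun setT (fun w => (X w, Y w)) by exact: measurable_fun_pair.
pose XY : {mfun T >-> (T1 * T2)%type} :=
  HB.pack (fun w => (X w, Y w)) (isMeasurableFun.Build _ _ _ _ _ mXY).
pose m1 : probability T1 R := distribution P X'; pose m2 : probability T2 R := distribution P Y'.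
pose h (z : T1 * T2) := f z.1 * g z.2.
have mh : measurable_fun setT h.
  by apply: measurable_funM; apply: measurableT_comp.
have hB z : `|h z| <= B * B by rewrite normrM ler_pM.
have E1 : (\int[P]_w (f (X w) * g (Y w))%:E = \int[distribution P XY]_z (h z)%:E)%E.
  rewrite integral_distribution //; first exact/measurable_EFinP.
  exact: (@bounded_integrable _ _ _ (h \o XY) _ (probability_lty P)
    (measurableT_comp mh mXY) (fun w => hB _)).
(* The joint law agrees with the product measure on rectangles, hence everywhere. *)
have E2 : (\int[distribution P XY]_z (h z)%:E = \int[m1 \x m2]_z (h z)%:E)%E.
  apply: eq_measure_integral => A mA _; apply/esym.
  by apply: product_measure_unique mA => A1 A2 mA1 mA2; exact: ind.
have ih : (m1 \x m2)%E.-integrable setT (EFin \o h).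
  apply: bounded_integrable mh hB => /=.
  rewrite -setXTT product_measure1E// -[X in (X < _)%E]/(m1 setT * m2 setT)%E.
  by rewrite !probability_setT mule1 ltry.
rewrite /Rintegral [in LHS](etrans E1 E2) -integral12_prod_meas1; last first.
  exact: ih.
have ig : m2.-integrable setT (EFin \o g) by exact: bounded_integrable (probability_lty m2) mg gB.
have if1 : m1.-integrable setT (EFin \o f) by exact: bounded_integrable (probability_lty m1) mf fB.
have ge : (\int[m2]_y (g y)%:E \is a fin_num)%E by exact: integrable_fin_num.
transitivity (fine (\int[m1]_x ((f x)%:E * \int[m2]_y (g y)%:E))%E).
  congr fine; apply: eq_integral => x _; rewrite -integralZl //.
transitivity (fine ((\int[m1]_x (f x)%:E) * \int[m2]_y (g y)%:E)%E).
  by rewrite -(fineK ge) integralZr.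
rewrite fineM ?integrable_fin_num //; congr (fine _ * fine _).
  rewrite integral_distribution //; first exact/measurable_EFinP.
  exact: (@bounded_integrable _ _ _ (f \o X') _ (probability_lty P)
    (measurableT_comp mf mX) (fun w => fB _)).
rewrite integral_distribution //; first exact/measurable_EFinP.
exact: (@bounded_integrable _ _ _ (g \o Y') _ (probability_lty P)
    (measurableT_comp mg mY) (fun w => gB _)).
Qed.

End BoundedReal.

Section BoundedMeasurable.
Context (R : realType).

Definition bmeasR d (T : measurableType d) (f : T -> R) :=
  measurable_fun setT f /\ exists B, forall x, `|f x| <= B.

(* Measurability in [R[i]] is expressed on real and imaginary parts, as the
   library has no sigma-algebra on [R[i]]. *)
Definition bmeas d (T : measurableType d) (f : T -> R[i]) :=
  bmeasR (fun x => complex.Re (f x)) /\ bmeasR (fun x => complex.Im (f x)).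

Section closure.
Context d (T : measurableType d).

Lemma bmeasR_cst (r : R) : bmeasR (cst r : T -> R).
Proof. by split; [exact: measurable_cst|exists `|r|]. Qed.

Lemma bmeasRD (f g : T -> R) : bmeasR f -> bmeasR g ->
  bmeasR (fun x => f x + g x).
Proof.
move=> [mf [A fA]] [mg [B gB]]; split; first exact: measurable_funD.
by exists (A + B) => x; rewrite (le_trans (ler_normD _ _)) // lerD.
Qed.

Lemma bmeasRM (f g : T -> R) : bmeasR f -> bmeasR g ->
  bmeasR (fun x => f x * g x).
Proof.
move=> [mf [A fA]] [mg [B gB]]; split; first exact: measurable_funM.
by exists (A * B) => x; rewrite normrM ler_pM.
Qed.

Lemma bmeasRN (f : T -> R) : bmeasR f -> bmeasR (fun x => - f x).
Proof.
move=> [mf [A fA]]; split; first exact: measurable_funN.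
by exists A => x; rewrite normrN.
Qed.

Lemma bmeas_cst (z : R[i]) : bmeas (cst z : T -> R[i]).
Proof. by split; apply: bmeasR_cst. Qed.

Lemma bmeasD (f g : T -> R[i]) : bmeas f -> bmeas g ->
  bmeas (fun x => f x + g x).
Proof.
move=> [fr fi] [gr gi]; split.
  under eq_fun do rewrite raddfD; exact: bmeasRD.
under eq_fun do rewrite raddfD; exact: bmeasRD.
Qed.

Lemma bmeasM (f g : T -> R[i]) : bmeas f -> bmeas g ->
  bmeas (fun x => f x * g x).
Proof.
move=> [fr fi] [gr gi]; split.
  have -> : (fun x => complex.Re (f x * g x)) = (fun x =>
      complex.Re (f x) * complex.Re (g x) + - (complex.Im (f x) * complex.Im (g x))).
    by apply/funext => x; case: (f x) => a b; case: (g x).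
  by apply: bmeasRD; [exact: bmeasRM|apply: bmeasRN; exact: bmeasRM].
have -> : (fun x => complex.Im (f x * g x)) = (fun x =>
      complex.Re (f x) * complex.Im (g x) + complex.Im (f x) * complex.Re (g x)).
  by apply/funext => x; case: (f x) => a b; case: (g x).
by apply: bmeasRD; exact: bmeasRM.
Qed.

Lemma bmeasJ (f : T -> R[i]) : bmeas f -> bmeas (fun x => (f x)^*%R).
Proof.
move=> [fr fi]; split.
  have -> : (fun x => complex.Re (f x)^*%R) = (fun x => complex.Re (f x)).
    by apply/funext => x; case: (f x).
  by [].
have -> : (fun x => complex.Im (f x)^*%R) = (fun x => - complex.Im (f x)).
  by apply/funext => x; case: (f x).
exact: bmeasRN.
Qed.

Lemma bmeas_sum (I : Type) (r : seq I) (p : pred I) (f : I -> T -> R[i]) :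
  (forall i, bmeas (f i)) -> bmeas (fun x => \sum_(i <- r | p i) f i x).
Proof.
move=> bf; elim: r => [|i r IH].
  by under eq_fun do rewrite big_nil; exact: bmeas_cst.
under eq_fun do rewrite big_cons; case: (p i) => //.
exact: bmeasD.
Qed.

End closure.

Lemma bmeas_comp d1 d2 (T1 : measurableType d1) (T2 : measurableType d2)
    (X : T1 -> T2) (f : T2 -> R[i]) :
  measurable_fun setT X -> bmeas f -> bmeas (fun w => f (X w)).
Proof.
move=> mX [[mr [A fA]] [mi [B fB]]]; split; split.
- exact: (measurableT_comp mr mX).
- by exists A.
- exact: (measurableT_comp mi mX).
- by exists B.
Qed.

Section expectation.
Context d (T : measurableType d) (mu : {measure set T -> \bar R}) (D : set T).
Hypothesis mD : measurable D.

Definition cint (f : T -> R[i]) :=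
  mu.-integrable D (EFin \o (fun x => complex.Re (f x))) /\
  mu.-integrable D (EFin \o (fun x => complex.Im (f x))).

Definition cE (f : T -> R[i]) : R[i] :=
  Complex (Rintegral mu D (fun x => complex.Re (f x)))
          (Rintegral mu D (fun x => complex.Im (f x))).

Lemma eq_cE (f g : T -> R[i]) : {in D, f =1 g} -> cE f = cE g.
Proof.
by move=> fg; rewrite /cE; congr Complex; apply: eq_Rintegral => x xD; rewrite fg.
Qed.

Lemma cint0 : cint (cst 0).
Proof. by split; exact: integrable0. Qed.

Lemma cintD (f g : T -> R[i]) : cint f -> cint g -> cint (fun x => f x + g x).
Proof.
move=> [fr fi] [gr gi]; split.
  under [X in EFin \o X]eq_fun do rewrite raddfD.
  exact: (integrableD mD fr gr).
under [X in EFin \o X]eq_fun do rewrite raddfD.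
exact: (integrableD mD fi gi).
Qed.

Lemma cintZ (z : R[i]) (f : T -> R[i]) : cint f -> cint (fun x => z * f x).
Proof.
move=> [fr fi]; case: z => a b; split.
  have -> : EFin \o (fun w => complex.Re (Complex a b * f w)) = (fun w =>
     a%:E * (complex.Re (f w))%:E - b%:E * (complex.Im (f w))%:E)%E.
    by apply/funext => x /=; case: (f x).
  by apply: integrableB => //; exact: integrableZl.
have -> : EFin \o (fun w => complex.Im (Complex a b * f w)) = (fun w =>
   a%:E * (complex.Im (f w))%:E + b%:E * (complex.Re (f w))%:E)%E.
  by apply/funext => x /=; case: (f x).
by apply: integrableD => //; exact: integrableZl.
Qed.

Lemma cint_sum (I : Type) (r : seq I) (p : pred I) (f : I -> T -> R[i]) :
  (forall i, cint (f i)) -> cint (fun x => \sum_(i <- r | p i) f i x).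
Proof.
move=> bf; elim: r => [|i r IH].
  by under eq_fun do rewrite big_nil; exact: cint0.
under eq_fun do rewrite big_cons; case: (p i) => //.
exact: cintD.
Qed.

Lemma cED (f g : T -> R[i]) : cint f -> cint g ->
  cE (fun x => f x + g x) = cE f + cE g.
Proof.
move=> [fr fi] [gr gi]; rewrite /cE.
under eq_Rintegral do rewrite raddfD.
under [X in Complex _ X]eq_Rintegral do rewrite raddfD.
by rewrite !RintegralD.
Qed.

Lemma cEZ (z : R[i]) (f : T -> R[i]) : cint f ->
  cE (fun x => z * f x) = z * cE f.
Proof.
move=> [fr fi].
have int (r : R) (g : T -> R) : mu.-integrable D (EFin \o g) ->
    mu.-integrable D (EFin \o (fun x => r * g x)).
  by move=> ig; exact: (integrableZl mD r ig).
have Z (r : R) (g : T -> R) : mu.-integrable D (EFin \o g) ->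
    Rintegral mu D (fun x => r * g x) = r * Rintegral mu D g.
  by move=> ig; rewrite RintegralZl.
case: z => a b.
have E1 : (fun w => complex.Re (Complex a b * f w)) = (fun w =>
   a * complex.Re (f w) - b * complex.Im (f w)) by apply/funext => x; case: (f _).
have E2 : (fun w => complex.Im (Complex a b * f w)) = (fun w =>
   a * complex.Im (f w) + b * complex.Re (f w)) by apply/funext => x; case: (f _).
rewrite /cE E1 E2.
rewrite RintegralB //; [|exact: int fr|exact: int fi].
rewrite RintegralD //; [|exact: int fi|exact: int fr].
by rewrite !(Z _ _ fr, Z _ _ fi).
Qed.

Lemma cE_sum (I : Type) (r : seq I) (p : pred I) (f : I -> T -> R[i]) :
  (forall i, cint (f i)) ->
  cE (fun x => \sum_(i <- r | p i) f i x) = \sum_(i <- r | p i) cE (f i).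
Proof.
move=> bf; elim: r => [|i r IH].
  under eq_fun do rewrite big_nil; rewrite big_nil.
  by rewrite /cE !Rintegral_cst // !mul0r.
rewrite big_cons -IH; under eq_fun do rewrite big_cons.
by case: (p i) => //; rewrite cED //; exact: cint_sum.
Qed.

(** In the partial order of [R[i]], comparable numbers have equal imaginary parts; hence an equality
    of integrals for the imaginary parts and an inequality for the real ones. *)
Lemma cE_le (f g : T -> R[i]) : cint f -> cint g ->
  (forall x, D x -> f x <= g x) -> cE f <= cE g.
Proof.
move=> [fr fi] [gr gi] fg; rewrite lecE /=; apply/andP; split.
  apply/eqP; apply: eq_Rintegral => x; rewrite inE => Dx.
  by have := fg x Dx; rewrite lecE => /andP[/eqP].
apply: le_Rintegral => // x Dx.
by have := fg x Dx; rewrite lecE => /andP[].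
Qed.

End expectation.

Section probability_expectation.
Context d (T : measurableType d) (P : probability T R).

Lemma bmeasR_integrable (f : T -> R) : bmeasR f ->
  P.-integrable setT (EFin \o f).
Proof. by move=> [mf [B fB]]; apply: bounded_integrable fB => //; exact: probability_lty. Qed.

Lemma bmeas_cint (f : T -> R[i]) : bmeas f -> cint P setT f.
Proof. by move=> [fr fi]; split; exact: bmeasR_integrable. Qed.

Lemma cE_cst (z : R[i]) : cE P setT (cst z) = z.
Proof.
have PT : fine (P setT) = 1 by rewrite probability_setT.
rewrite /cE !Rintegral_cst // PT !mulr1.
by case: z.
Qed.

End probability_expectation.

Lemma cE_indep d d1 d2 (T : measurableType d) (T1 : measurableType d1)
    (T2 : measurableType d2) (P : probability T R) (X : T -> T1) (Y : T -> T2)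
    (f : T1 -> R[i]) (g : T2 -> R[i]) :
  measurable_fun setT X -> measurable_fun setT Y ->
  (forall A B, measurable A -> measurable B ->
     P (X @^-1` A `&` Y @^-1` B) = P (X @^-1` A) * P (Y @^-1` B))%E ->
  bmeas f -> bmeas g ->
  cE P setT (fun w => f (X w) * g (Y w)) =
  cE P setT (fun w => f (X w)) * cE P setT (fun w => g (Y w)).
Proof.
move=> mX mY ind bf bg.
have ind1 (f1 : T1 -> R) (g1 : T2 -> R) : bmeasR f1 -> bmeasR g1 ->
    Rintegral P setT (fun w => f1 (X w) * g1 (Y w)) =
    Rintegral P setT (fun w => f1 (X w)) * Rintegral P setT (fun w => g1 (Y w)).
  move=> [mf [A fA]] [mg [B gB]].
  apply: (@Rintegral_indep _ _ _ _ _ _ _ _ _ _ _ _ (Num.max A B)) => // x.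
    by rewrite le_max fA.
  by rewrite le_max gB orbT.
have int1 (f1 : T1 -> R) (g1 : T2 -> R) : bmeasR f1 -> bmeasR g1 ->
    P.-integrable setT (EFin \o (fun w => f1 (X w) * g1 (Y w))).
  move=> [mf [A fA]] [mg [B gB]]; apply: bmeasR_integrable; apply: bmeasRM.
    by split; [exact: (measurableT_comp mf mX)|exists A].
  by split; [exact: (measurableT_comp mg mY)|exists B].
have [fr fi] := bf; have [gr gi] := bg.
have E1 : (fun w => complex.Re (f (X w) * g (Y w))) = (fun w =>
   complex.Re (f (X w)) * complex.Re (g (Y w)) - complex.Im (f (X w)) * complex.Im (g (Y w))).
  by apply/funext => x; case: (f _) => a b; case: (g _).
have E2 : (fun w => complex.Im (f (X w) * g (Y w))) = (fun w =>
   complex.Re (f (X w)) * complex.Im (g (Y w)) + complex.Im (f (X w)) * complex.Re (g (Y w))).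
  by apply/funext => x; case: (f _) => a b; case: (g _).
rewrite /cE E1 E2.
rewrite RintegralB //; [|exact: (int1 _ _ fr gr)|exact: (int1 _ _ fi gi)].
rewrite RintegralD //; [|exact: (int1 _ _ fr gi)|exact: (int1 _ _ fi gr)].
by rewrite !(ind1 _ _ fr gr, ind1 _ _ fi gi, ind1 _ _ fr gi, ind1 _ _ fi gr).
Qed.

End BoundedMeasurable.

(** * Independence of one sample from all the others *)

Section Independence.
Context (R : realType) d (Omega : measurableType d) (P : probability Omega R).
Context d1 (T1 : measurableType d1).

Lemma cE_distribution (mu : probability T1 R) (X : Omega -> T1) (f : T1 -> R[i]) :
  measurable_fun setT X ->
  (forall B, measurable B -> P (X @^-1` B) = mu B) -> bmeas f ->
  cE P setT (fun w => f (X w)) = cE mu setT f.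
Proof.
move=> mX dX bf.
pose X' : {mfun Omega >-> T1} := HB.pack X (isMeasurableFun.Build _ _ _ _ X mX).
have real (g : T1 -> R) : bmeasR g ->
    Rintegral P setT (fun w => g (X w)) = Rintegral mu setT g.
  move=> [mg [B gB]]; rewrite /Rintegral; congr fine.
  transitivity (\int[distribution P X']_y (g y)%:E)%E.
    rewrite integral_distribution //; first exact/measurable_EFinP.
    exact: (@bounded_integrable _ _ _ _ (g \o X') _ (probability_lty P)
      (measurableT_comp mg mX) (fun w => gB _)).
  by apply: eq_measure_integral => A mA _; exact: dX.
by have [fr fi] := bf; rewrite /cE (real _ fr) (real _ fi).
Qed.

Variables (M : nat) (X : 'I_M -> Omega -> T1).
Hypothesis mX : forall m, measurable_fun setT (X m).
Hypothesis indX : forall (J : {set 'I_M}) (B : 'I_M -> set T1),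
  (forall m, measurable (B m)) ->
  P (\bigcap_(m in [set` J]) (X m @^-1` B m)) =
  (\prod_(m in J) P (X m @^-1` B m))%E.

(* A pi-system generating the sigma-algebra of all the samples but the [j]-th. *)
Definition rectangles_off (j : 'I_M) : set (set Omega) :=
  [set A | exists2 B : 'I_M -> set T1, (forall m, measurable (B m)) &
     A = \bigcap_(m in [set` [set~ j]%SET]) (X m @^-1` B m)].

Lemma rectangles_off_setI j : setI_closed (rectangles_off j).
Proof.
move=> _ _ [A mA ->] [B mB ->]; exists (fun m => A m `&` B m).
  by move=> m; exact: measurableI.
by rewrite -bigcapI; apply: eq_bigcapr => m _; rewrite preimage_setI.
Qed.

Lemma rectangles_off_measurable j A : rectangles_off j A -> measurable A.
Proof.
move=> [B mB ->]; apply: fin_bigcap_measurable => // m _.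
by rewrite -[X in measurable X]setTI; apply: mX.
Qed.

(** Measurability of the identity says that the sigma-algebra of the samples other than [j] is
    contained in that of [Omega]. It lets the identity serve as the second variable in
    [cE_indep]. *)
Lemma measurable_sigma_off j :
  measurable_fun setT (id : Omega -> g_sigma_algebraType (rectangles_off j)).
Proof.
move=> _ A mA; rewrite setTI preimage_id; move: A mA.
apply: smallest_sub; first exact: sigma_algebra_measurable.
exact: rectangles_off_measurable.
Qed.

Lemma measurable_sigma_offX j m : m != j ->
  measurable_fun setT (X m : g_sigma_algebraType (rectangles_off j) -> T1).
Proof.
move=> mj _ B mB; rewrite setTI; apply: sub_sigma_algebra.
exists (fun k => if k == m then B else setT) => [k|]; first by case: ifP.
apply/seteqP; split => w /=.
  by move=> Bw k /= _; case: eqP => // ->.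
by move=> /(_ m); rewrite eqxx; apply; rewrite /= !inE.
Qed.

(** As functions of [S], both sides are finite measures: [P] restricted to [E], and [P] scaled by
    [P E]. They agree on the pi-system of rectangles, hence on the sigma-algebra that it
    generates. *)
Lemma sigma_off_indep j (A : set T1) (S : set (g_sigma_algebraType (rectangles_off j))) :
  measurable A -> measurable S ->
  P (X j @^-1` A `&` S) = (P (X j @^-1` A) * P S)%E.
Proof.
move=> mA mS; set E := X j @^-1` A.
have mE : measurable E by rewrite -[X in measurable X]setTI; apply: mX.
have PE0 : 0 <= fine (P E) by rewrite fine_ge0.
have PEE : P E = (fine (P E))%:E by rewrite fineK // fin_num_measure.
pose m1 : {measure set Omega -> \bar R} := mrestr P mE.
pose m2 : {measure set Omega -> \bar R} := mscale (NngNum PE0) P.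
rewrite setIC -[LHS]/(m1 S) PEE -[RHS]/(m2 S).
apply: (g_sigma_algebra_measure_unique (rectangles_off j) _ (fun=> setT)) => //.
- exact: rectangles_off_measurable.
- move=> _; exists (fun=> setT) => //.
  by apply/esym/seteqP; split => // w _ m.
- by rewrite bigcup_const //; exists 0%N.
- exact: rectangles_off_setI.
- move=> _ [B mB ->]; rewrite /m1 /m2 /= /mscale /mrestr /= -PEE.
  (* Filling the free slot [j] with [A] makes the intersection a rectangle over all samples, to
     which [indX] applies. *)
  pose B' m := if m == j then A else B m.
  have mB' m : measurable (B' m) by rewrite /B'; case: ifP.
  have -> : \bigcap_(m in [set` [set~ j]%SET]) X m @^-1` B m `&` E =
            \bigcap_(m in [set` [set: 'I_M]%SET]) X m @^-1` B' m.
    apply/seteqP; split => w.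
      move=> [Bw Ew] m _; rewrite /B' /=; case: eqP => [->//|/eqP mj].
      by apply: Bw; rewrite /= !inE.
    move=> B'w; split; last by have := B'w j; rewrite /B' /= eqxx; apply; rewrite inE.
    move=> m /=; rewrite !inE => mj.
    by have := B'w m; rewrite /B' /= (negbTE mj); apply; rewrite inE.
  rewrite !indX // (bigD1 j) ?inE //= /B' eqxx; congr (_ * _)%E.
  apply: eq_big => [m|m]; first by rewrite !inE.
  by move=> /andP[_ mj]; rewrite (negbTE mj).
- by move=> _; rewrite ltey_eq fin_num_measure.
Qed.

Lemma cE_indep_off j (f : T1 -> R[i])
    (g : g_sigma_algebraType (rectangles_off j) -> R[i]) :
  bmeas f -> bmeas g ->
  cE P setT (fun w => f (X j w) * g w) = cE P setT (fun w => f (X j w)) * cE P setT g.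
Proof.
move=> bf bg; apply: (cE_indep (mX j) (@measurable_sigma_off j) _ bf bg).
by move=> A B mA mB; exact: sigma_off_indep.
Qed.

End Independence.

(** * Lower tail of a sampled Gram matrix *)

Lemma qform_cauchy_schwarz (C : numClosedFieldType) n (u v : 'cV[C]_n) :
  `|(u ^t* *m v) 0 0| ^+ 2 <= qform 1 u * qform 1 v.
Proof.
have E (x y : 'cV[C]_n) : (x ^t* *m y) 0 0 = dotmx y^T x^T.
  by rewrite dotmxE !mxE; apply: eq_bigr => i _; rewrite !mxE mulrC.
have Q (x : 'cV[C]_n) : qform 1 x = dotmx x^T x^T by rewrite /qform mulmx1 E.
rewrite E !Q mulrC; exact: CauchySchwarz.
Qed.

Section MatrixChernoff.
Context (R : realType) d (Omega : measurableType d) (P : probability Omega R).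
Context d1 (T1 : measurableType d1) (mu : probability T1 R).
Local Notation C := R[i].
Variables (M : nat) (X : 'I_M -> Omega -> T1).
Hypothesis M0 : (0 < M)%N.
Hypothesis mX : forall m, measurable_fun setT (X m).
Hypothesis distX : forall m B, measurable B -> P (X m @^-1` B) = mu B.
Hypothesis indX : forall (J : {set 'I_M}) (B : 'I_M -> set T1),
  (forall m, measurable (B m)) ->
  P (\bigcap_(m in [set` J]) (X m @^-1` B m)) =
  (\prod_(m in J) P (X m @^-1` B m))%E.
Variables (n : nat) (u : T1 -> 'cV[C]_n) (K : R).
Hypothesis K1 : 1 <= K.
Hypothesis bu : forall k, bmeas (fun x => u x k 0).
Hypothesis uK : forall x, qform 1 (u x) <= K%:C%C.
Hypothesis ortho : forall k l,
  cE mu setT (fun x => (u x k 0)^* * u x l 0) = (k == l)%:R.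

Let k : C := K%:C%C.
Let k1 : 1 <= k. Proof. by rewrite /k -[1]/((1 : R)%:C%C) lecR. Qed.
Let k0 : 0 < k. Proof. exact: lt_le_trans ltr01 k1. Qed.
Let m : C := M%:R.
Let m0 : 0 < m. Proof. by rewrite ltr0n. Qed.
Let eta : C := (4%:R * m * k)^-1.
Let eta0 : 0 < eta. Proof. by rewrite invr_gt0 !mulr_gt0. Qed.

(** [J] is the set of samples kept. The factor [eta] does not depend on [J], so leaving out one
    sample is an exact rank-one change. *)
Definition gramH (J : {set 'I_M}) (w : Omega) : 'M[C]_n :=
  1 - eta *: \sum_(j in J) (u (X j w) *m (u (X j w)) ^t*).

Lemma qform_gramH J w v : qform (gramH J w) v =
  qform 1 v - eta * \sum_(j in J) `|((u (X j w)) ^t* *m v) 0 0| ^+ 2.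
Proof.
rewrite qformB qformZ qform_sum; congr (_ - _ * _).
by apply: eq_bigr => j _; rewrite qform_rank1.
Qed.

(** By Cauchy-Schwarz each of the at most [M] terms is bounded by [K * qform 1 v], and
    [eta * M * K = 1/4]. *)
Lemma gramH_lower J w v : 3%:R / 4%:R * qform 1 v <= qform (gramH J w) v.
Proof.
have S : \sum_(j in J) `|((u (X j w)) ^t* *m v) 0 0| ^+ 2 <= m * k * qform 1 v.
  rewrite (@le_trans _ _ (\sum_(j in J) k * qform 1 v)) //.
    rewrite ler_sum // => j _; apply: (le_trans (qform_cauchy_schwarz _ _)).
    by rewrite ler_wpM2r ?qform1_ge0.
  rewrite sumr_const -mulr_natl mulrA ler_wpM2r ?qform1_ge0 //.
  rewrite ler_wpM2r ?(ltW k0) // ler_nat.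
  by rewrite -[X in (_ <= X)%N](card_ord M) max_card.
rewrite qform_gramH; apply: (@le_trans _ _ (qform 1 v - eta * (m * k * qform 1 v))).
  rewrite [X in _ <= X](_ : _ = 3%:R / 4%:R * qform 1 v) // /eta; field.
  by rewrite !gt_eqF.
by rewrite lerD2l lerN2 ler_wpM2l // ltW.
Qed.

Lemma gramH_psd J w : psd (gramH J w).
Proof.
split; last first.
  by move=> v; apply: le_trans (gramH_lower J w v); rewrite mulr_ge0 ?qform1_ge0 ?divr_ge0.
have etaR : eta^* = eta by apply: CrealP; rewrite realE ltW.
apply/matrixP => i j; rewrite !mxE rmorphB rmorphM /= etaR conjC_nat eq_sym.
congr (_ - _ * _); rewrite !summxE rmorph_sum; apply: eq_bigr => l _.
by rewrite !mxE !big_ord1 !mxE rmorphM /= conjCK mulrC.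
Qed.

Lemma gramHD1 j w : gramH [set: 'I_M]%SET w =
  gramH [set~ j]%SET w - eta *: (u (X j w) *m (u (X j w)) ^t*).
Proof.
rewrite /gramH (bigD1 j) ?inE //= scalerDr opprD addrCA addrC; congr (_ - _ *: _ - _).
by apply: eq_bigl => i; rewrite !inE.
Qed.

(** [Y] will be the identity, but with source [Omega] under either its own sigma-algebra or the one
    generated by [rectangles_off]. For the latter it matters that only the samples in [J] are asked
    to be measurable. *)
Lemma bmeas_gramHX d' (T : measurableType d') (Y : T -> Omega) (J : {set 'I_M}) p :
  (forall j, j \in J -> measurable_fun setT (fun w => X j (Y w))) ->
  forall a b, bmeas (fun w => (gramH J (Y w) ^+ p) a b).
Proof.
move=> mY; elim: p => [|p IH] a b.
  by under eq_fun do rewrite expr0 mxE; exact: bmeas_cst.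
have bH c : bmeas (fun w => gramH J (Y w) a c).
  have -> : (fun w => gramH J (Y w) a c) = (fun w => (1%:M a c) +
      (- eta) * \sum_(j in J) (u (X j (Y w)) a 0 * (u (X j (Y w)) c 0)^*)).
    apply/funext => w; rewrite /gramH !mxE mulNr summxE; congr (_ - _ * _).
    by apply: eq_bigr => j _; rewrite !mxE big_ord1 !mxE.
  apply: bmeasD; first exact: bmeas_cst.
  apply: bmeasM; first exact: bmeas_cst.
  under eq_fun do rewrite big_mkcond; apply: bmeas_sum => j.
  have [jJ|_] := boolP (j \in J); last exact: bmeas_cst.
  apply: bmeasM; first exact: bmeas_comp (mY j jJ) (bu a).
  exact: bmeasJ (bmeas_comp (mY j jJ) (bu c)).
under eq_fun do rewrite exprS mxE.
by apply: bmeas_sum => c; apply: bmeasM.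
Qed.

Lemma bmeas_trH J p : bmeas (fun w => \tr (gramH J w ^+ p)).
Proof. by apply: bmeas_sum => a; exact: (@bmeas_gramHX _ _ id). Qed.

Lemma bmeas_qformH J p j : bmeas (fun w => qform (gramH J w ^+ p) (u (X j w))).
Proof.
under eq_fun do rewrite qform_entries.
apply: bmeas_sum => a; apply: bmeas_sum => b; apply: bmeasM.
  apply: bmeasM; last exact: bmeas_comp (mX j) (bu b).
  exact: bmeasJ (bmeas_comp (mX j) (bu a)).
exact: (@bmeas_gramHX _ _ id).
Qed.

(** The form is expanded in entries. Sample [j] is independent of the matrix built from the others,
    and orthonormality makes the expectation of [conj (u_a) * u_b] a Kronecker delta, so that only
    the diagonal survives. *)
Lemma cE_qform_off j p :
  cE P setT (fun w => qform (gramH [set~ j]%SET w ^+ p) (u (X j w))) =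
  cE P setT (fun w => \tr (gramH [set~ j]%SET w ^+ p)).
Proof.
have buu a b : bmeas (fun x => (u x a 0)^* * u x b 0).
  by apply: bmeasM => //; exact: bmeasJ.
have bH a b : bmeas (fun w => (gramH [set~ j]%SET w ^+ p) a b) := 
  @bmeas_gramHX _ _ id _ p (fun _ _ => mX _) a b.
under eq_fun do rewrite qform_entries.
have bt a b : bmeas (fun w => (u (X j w) a 0)^* * u (X j w) b 0 *
      (gramH [set~ j]%SET w ^+ p) a b).
  by apply: bmeasM => //; exact: (bmeas_comp (mX j) (buu a b)).
rewrite cE_sum //; last by move=> a; apply: bmeas_cint; apply: bmeas_sum.
rewrite /mxtrace cE_sum //; last by move=> a; exact: bmeas_cint.
apply: eq_bigr => a _.
have cov b : cE P setT (fun w => (u (X j w) a 0)^* * u (X j w) b 0) = (a == b)%:R.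
  by rewrite -(ortho a b); exact: (cE_distribution (mX j) (distX j) (buu a b)).
have bHoff b : bmeas ((fun w => (gramH [set~ j]%SET w ^+ p) a b) :
    g_sigma_algebraType (rectangles_off X j) -> C).
  apply: (@bmeas_gramHX _ (g_sigma_algebraType (rectangles_off X j)) id) => i.
  by rewrite !inE => ij; exact: measurable_sigma_offX.
have prodE b : cE P setT (fun w => (u (X j w) a 0)^* * u (X j w) b 0 *
    (gramH [set~ j]%SET w ^+ p) a b) =
    (a == b)%:R * cE P setT (fun w => (gramH [set~ j]%SET w ^+ p) a b).
  by rewrite -cov; exact: (cE_indep_off mX indX (buu a b) (bHoff b)).
rewrite cE_sum //; last by move=> b; exact: bmeas_cint.
rewrite (bigD1 a) //= prodE eqxx mul1r big1 ?addr0 // => b ba.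
by rewrite prodE eq_sym (negbTE ba) mul0r.
Qed.

Let F p := cE P setT (fun w => \tr (gramH [set: 'I_M]%SET w ^+ p)).

Lemma cE_qform_lower j p : (p <= M)%N ->
  2%:R / 3%:R * F p <= cE P setT (fun w => qform (gramH [set: 'I_M]%SET w ^+ p) (u (X j w))).
Proof.
move=> pM; have c23 : 0 <= 2%:R / 3%:R :> C by apply: divr_ge0; exact: ler0n.
apply: (@le_trans _ _ (2%:R / 3%:R *
  cE P setT (fun w => qform (gramH [set~ j]%SET w ^+ p) (u (X j w))))).
  rewrite cE_qform_off; apply: (ler_wpM2l c23).
  apply: cE_le => //; [exact: bmeas_cint (bmeas_trH _ _)|exact: bmeas_cint (bmeas_trH _ _)|].
  (* Leaving out a sample subtracts less from the identity, so the form, and with it the trace of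
     each power, can only grow. *)
  move=> w _; apply: mxtraceX_mono; try exact: gramH_psd.
  move=> v; rewrite (gramHD1 j) qformB gerBl qformZ qform_rank1.
  by rewrite mulr_ge0 ?exprn_ge0 // ltW.
have <- : cE P setT (fun w => 2%:R / 3%:R * qform (gramH [set~ j]%SET w ^+ p) (u (X j w))) =
   2%:R / 3%:R * cE P setT (fun w => qform (gramH [set~ j]%SET w ^+ p) (u (X j w))).
  by rewrite cEZ //; exact: bmeas_cint (bmeas_qformH _ _ _).
apply: cE_le => //; [|exact: bmeas_cint (bmeas_qformH _ _ _)|].
  exact: cintZ (bmeas_cint _ (bmeas_qformH _ _ _)).
move=> w _; rewrite (gramHD1 j).
apply: (@rank_one_power_lower _ _ _ _ k); last 1 first.
(* [eta * K * p = p / (4 * M)]; this is where [p <= M] enters. *)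
- rewrite /eta (_ : _ * k * _ = p%:R / m / 4%:R); last by field; rewrite !gt_eqF.
  by rewrite ler_pdivrMr // mulVf ?pnatr_eq0 // ler_pdivrMr // mul1r ler_nat.
- exact: gramH_psd.
- by rewrite -gramHD1; exact: gramH_psd.
- exact: gramH_lower.
- exact: ltW.
- exact: uK.
Qed.

Lemma cE_trH_step p : (p <= M)%N -> F p.+1 <= (1 - (6%:R * k)^-1) * F p.
Proof.
move=> pM.
have -> : F p.+1 = F p - eta *
    \sum_j cE P setT (fun w => qform (gramH [set: 'I_M]%SET w ^+ p) (u (X j w))).
  have iq j : cint P setT (fun w => qform (gramH [set: 'I_M]%SET w ^+ p) (u (X j w))).
    by apply: bmeas_cint; exact: bmeas_qformH.
  rewrite -cE_sum // -mulNr -cEZ //; last exact: cint_sum.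
  rewrite -cED //; last 2 first.
  - by apply: bmeas_cint; exact: bmeas_trH.
  - by apply: cintZ => //; exact: cint_sum.
  apply: eq_cE => w _.
  (* Only the last factor of [H ^+ p.+1] is expanded; cyclicity of the trace turns each rank-one
     term into a quadratic form. *)
  rewrite exprSr {2}/gramH mulrBr mulr1 linearB /= mulNr; congr (_ - _).
  rewrite -mulmxE -scalemxAr linearZ /= mulmx_sumr linear_sum /=.
  congr (_ * _); apply: eq_big => [j|j _]; first by rewrite inE.
  by rewrite mulmxA mxtrace_mulC mulmxA /qform trace_mx11.
have S : m * (2%:R / 3%:R * F p) <=
    \sum_j cE P setT (fun w => qform (gramH [set: 'I_M]%SET w ^+ p) (u (X j w))).
  rewrite /m -[M in X in X <= _]card_ord -sum1_card natr_sum mulr_suml ler_sum // => j _.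
  by rewrite mul1r cE_qform_lower.
apply: (@le_trans _ _ (F p - eta * (m * (2%:R / 3%:R * F p)))).
  by rewrite lerD2l lerN2 ler_wpM2l // ltW.
(* The rate is [eta * M * 2/3 = 1 / (6 * K)]. *)
rewrite [X in X <= _](_ : _ = (1 - (6%:R * k)^-1) * F p) // /eta; field.
by rewrite !gt_eqF.
Qed.

Lemma cE_trH_decay p : (p <= M)%N -> F p <= (1 - (6%:R * k)^-1) ^+ p * n%:R.
Proof.
elim: p => [|p IH] pM.
  rewrite expr0 mul1r /F; under eq_fun do rewrite expr0 mxtrace1.
  by rewrite cE_cst.
apply: (le_trans (cE_trH_step (ltnW pM))).
rewrite exprS -mulrA ler_wpM2l ?IH ?(ltnW pM) // subr_ge0.
rewrite invf_le1 ?mulr_gt0 // (le_trans k1) // ler_pMl // ler1n //.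
Qed.

Lemma markov_trH (t : R) : 0 <= t ->
  let E := [set w | t ^+ M <= complex.Re (\tr (gramH [set: 'I_M]%SET w ^+ M))] in
  measurable E /\
  t ^+ M * fine (P E) <= (1 - (6%:R * K)^-1) ^+ M * n%:R.
Proof.
move=> t0 E; have [[mre bre] _] := bmeas_trH [set: 'I_M]%SET M.
set g := fun w => _ in mre bre.
have mE : measurable E.
  rewrite -[E]setTI; have := measurable_fun_ler (measurable_cst (t ^+ M)) mre.
  by move=> /(_ measurableT [set true]); apply.
have g0 w : 0 <= g w.
  have [P0 [dd [_ _ trE dE]]] := spectral_form (gramH_psd [set: 'I_M]%SET w).1.
  suff : 0 <= \tr (gramH [set: 'I_M]%SET w ^+ M) by rewrite lecE => /andP[].
  rewrite trE sumr_ge0 // => i _; have [-> _] := dE i.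
  by rewrite exprn_ge0 // (gramH_psd _ _).2.
split=> //.
have := cE_trH_decay (leqnn M).
have -> : (1 - (6%:R * k)^-1) ^+ M * n%:R = ((1 - (6%:R * K)^-1) ^+ M * n%:R)%:C%C.
  by rewrite rmorphM rmorphXn rmorphB rmorph1 fmorphV rmorphM !rmorph_nat.
rewrite lecE => /andP[_]; apply: le_trans.
rewrite /F /cE /= -/g.
have bind : bmeasR (\1_E : Omega -> R).
  split; first exact: measurable_indic.
  by exists 1 => w; rewrite indicE; case: (_ \in _); rewrite ?normr1 ?normr0.
have bc : bmeasR (fun w => t ^+ M * \1_E w).
  by apply: bmeasRM => //; exact: bmeasR_cst.
rewrite (_ : t ^+ M * fine (P E) = Rintegral P setT (fun w => t ^+ M * \1_E w)).
  apply: le_Rintegral => //; [exact: bmeasR_integrable|exact: bmeasR_integrable|].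
  move=> w _; rewrite indicE; have [|_] := boolP (w \in E).
    by rewrite inE mulr1.
  by rewrite mulr0; exact: g0.
rewrite RintegralZl //; last exact: bmeasR_integrable.
by rewrite /Rintegral integral_indic // setIT.
Qed.

(** [E] is the event that the trace of [H ^+ M] reaches [t ^+ M] with [t = 1 - 1 / (24 * K)]. Off
    [E] every eigenvalue of [H] is at most [t], which is a lower bound on the sampled Gram matrix;
    Markov's inequality bounds the probability of [E]. *)
Theorem matrix_chernoff_lower : exists E : set Omega, [/\ measurable E,
  fine (P E) <= n%:R * (1 - (8%:R * K)^-1) ^+ M &
  forall w, ~ E w -> forall v : 'cV[C]_n,
    M%:R / 6%:R * qform 1 v <=
    \sum_(j < M) `|((u (X j w)) ^t* *m v) 0 0| ^+ 2].
Proof.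
have K0 : 0 < K by apply: lt_le_trans K1.
pose t := 1 - (24%:R * K)^-1.
have inv1 (c : R) : 1 <= c -> 0 < c * K /\ (c * K)^-1 <= 1.
  move=> c1; have cK : 0 < c * K by rewrite mulr_gt0 // (lt_le_trans ltr01).
  by split=> //; rewrite invf_le1 // mulr_ege1.
have t0 : 0 < t.
  rewrite subr_gt0 invf_lt1 ?mulr_gt0 //.
  by apply: (@lt_le_trans _ _ 24%:R); [rewrite ltr1n|rewrite ler_peMr].
have [mE PE] := markov_trH (ltW t0).
set E := [set w | _] in mE PE; exists E; split=> //.
  rewrite -(ler_pM2l (exprn_gt0 M t0)); apply: (le_trans PE).
  have h6 : 0 <= 1 - (6%:R * K)^-1 by rewrite subr_ge0; apply: (inv1 _ _).2; rewrite ler1n.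
  have h8 : 0 <= 1 - (8%:R * K)^-1 by rewrite subr_ge0; apply: (inv1 _ _).2; rewrite ler1n.
  rewrite mulrCA mulrC ler_wpM2l // -exprMn lerXn2r ?nnegrE ?mulr_ge0 ?(ltW t0) //.
  rewrite /t -subr_ge0.
  (* As [1/24 + 1/8 = 1/6], the product of [t] and [1 - 1 / (8 * K)] exceeds [1 - 1 / (6 * K)] by
     exactly this cross term. *)
  rewrite (_ : _ - _ = (24%:R * K)^-1 * (8%:R * K)^-1); last first.
    by field; rewrite gt_eqF.
  by rewrite mulr_ge0 // invr_ge0 mulr_ge0 // ltW.
move=> w nE v.
have [hA A0] := gramH_psd [set: 'I_M]%SET w.
have tr0 : 0 <= \tr (gramH [set: 'I_M]%SET w ^+ M).
  have [P0 [dd [_ _ -> dE]]] := spectral_form hA.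
  by rewrite sumr_ge0 // => i _; have [-> _] := dE i; rewrite exprn_ge0.
have trlt : \tr (gramH [set: 'I_M]%SET w ^+ M) < (t%:C%C) ^+ M.
  rewrite -rmorphXn ltcE /= (ger0_Im tr0) eqxx /= ltNge.
  exact/negP.
have t0c : 0 <= t%:C%C :> C by rewrite ler0c ltW.
have := qform_le_of_mxtraceX v (gramH_psd [set: 'I_M]%SET w) t0c trlt.
rewrite qform_gramH.
rewrite (eq_bigl predT); last by move=> j; rewrite inE.
set S := \sum_j _; set q := qform 1 v => le.
have tE : t%:C%C = 1 - (24%:R * k)^-1 :> C.
  by rewrite /t rmorphB rmorph1 fmorphV rmorphM rmorph_nat.
(* Dividing by [eta = 1 / (4 * M * K)] turns [1 / (24 * K)] into [M / 6]. *)
have : (24%:R * k)^-1 * q <= eta * S.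
  rewrite -subr_ge0 in le; rewrite -subr_ge0; apply: (le_trans le).
  by rewrite tE le_eqVlt; apply/orP; left; apply/eqP; ring.
move=> /(ler_wpM2l (_ : 0 <= eta^-1)); rewrite invr_ge0 ltW // => /(_ isT).
rewrite mulKf ?gt_eqF //; apply: le_trans.
rewrite le_eqVlt; apply/orP; left; apply/eqP; rewrite /eta; field.
by rewrite !gt_eqF.
Qed.

End MatrixChernoff.

(** * The support has full measure *)

Section Support.
Context (R : realType) (d : nat) (mu : probability (borelRd R d) R).

Lemma open_measurable_rV (U : set 'rV[R]_d) :
  open U -> measurable (U : set (borelRd R d)).
Proof. by move=> oU; apply: sub_sigma_algebra. Qed.

Lemma open_suppC : open (~` supp mu : set 'rV[R]_d).
Proof.
rewrite (_ : ~` supp mu = \bigcup_(U in [set U : set 'rV[R]_d | open U /\ mu U = 0%E]) U).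
  by apply: bigcup_open => U [].
apply/seteqP; split => [x /= nx|x [U [oU U0] Ux] sx].
  apply: contrapT => nU; apply: nx => U oU Ux.
  rewrite lt0e measure_ge0 andbT; apply/eqP => U0; apply: nU.
  by exists U.
by have := sx U oU Ux; rewrite U0 ltxx.
Qed.

Lemma measurable_supp : measurable (supp mu).
Proof. by rewrite -[supp mu]setCK; apply: measurableC; exact: (open_measurable_rV open_suppC). Qed.

Lemma rational_ball (x : 'rV[R]_d) (U : set 'rV[R]_d) : open U -> U x ->
  exists (q : 'rV[rat]_d) (k : nat),
    ball (map_mx ratr q : 'rV[R]_d) k.+1%:R^-1 x /\
    ball (map_mx ratr q : 'rV[R]_d) k.+1%:R^-1 `<=` U.
Proof.
move=> oU Ux; have /nbhs_ballP[e /= e0 eU] : nbhs x U by exact: open_nbhs_nbhs.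
have [k ke] : exists k : nat, k.+1%:R^-1 < e / 2%:R.
  have [k _ /(_ k (leqnn k)) ke] := near_infty_natSinv_lt (PosNum (divr_gt0 e0 (ltr0Sn R 1))).
  by exists k.
have k0 : 0 < k.+1%:R^-1 :> R by rewrite invr_gt0 ltr0n.
have qP i : exists q : rat, `|ratr q - x 0 i| < k.+1%:R^-1.
  have [q] : exists q : rat, ratr q \in `]x 0 i - k.+1%:R^-1, x 0 i + k.+1%:R^-1[.
    by apply: rat_in_itvoo; rewrite ltrD2l gtrN.
  by rewrite in_itv /= => qI; exists q; rewrite ltr_distl.
have [q qE] := choice qP.
exists (\row_i q i), k.
have xq : ball (map_mx ratr (\row_i q i) : 'rV[R]_d) k.+1%:R^-1 x.
  by split=> // i j; rewrite !mxE ord1; exact: qE.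
split=> // y yq; apply: eU.
have := ball_triangle (ball_sym xq) yq; apply: le_ball.
by rewrite [leRHS]splitr lerD // ltW.
Qed.

(** Each point off the support lies in a null open set, and between the two fits a ball with
    rational centre and radius [1 / (k+1)]. There are countably many such balls, so countably many
    null open sets cover the complement. *)
Lemma suppC_null : mu (~` supp mu) = 0%E.
Proof.
have mS : measurable (~` supp mu) by apply: measurableC; exact: measurable_supp.
pose null (i : 'rV[rat]_d * nat) := [set U : set 'rV[R]_d |
  [/\ open U, mu U = 0%E & ball (map_mx ratr i.1 : 'rV[R]_d) i.2.+1%:R^-1 `<=` U]].
(* [W] enumerates, through [pickle], one null open set around each rational ball that admits one;
   the default [set0] is null as well. *)
pose W (k : nat) : set (borelRd R d) :=
  if @choice.unpickle ('rV[rat]_d * nat)%type k is Some i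
  then xget set0 (null i) else set0.
have W0 k : measurable (W k) /\ mu (W k) = 0%E.
  rewrite /W; case: choice.unpickle => [i|]; last by split; [exact: measurable0|exact: measure0].
  case: xgetP => [U _ [oU U0 _]|_]; first by split; [exact: open_measurable_rV|].
  by split; [exact: measurable0|exact: measure0].
have : mu.-negligible (\bigcup_k W k).
  apply: negligible_bigcup => k; exists (W k); split; [exact: (W0 k).1|exact: (W0 k).2|by []].
move=> /(negligibleS (_ : ~` supp mu `<=` _)) ng.
apply/eqP; rewrite -measure_le0; have /ng : ~` supp mu `<=` \bigcup_k W k.
  move=> x nx; have [U [oU U0 Ux]] : exists U, [/\ open U, mu U = 0%E & U x].
    apply: contrapT => nU; apply: nx => U oU Ux.
    by rewrite lt0e measure_ge0 andbT; apply/eqP => U0; apply: nU; exists U.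
  have [q [k [xq qU]]] := rational_ball oU Ux.
  exists (choice.pickle (q, k)) => //; rewrite /W choice.pickleK.
  case: xgetP => [V _ [_ _ bV]|/(_ U)]; first exact: bV.
  by case.
by move=> [A [mA A0 SA]]; rewrite -A0 le_measure ?inE.
Qed.

End Support.

(** * Orthonormal bases in L^2 *)

(** In an eigenbasis of [G] the eigenvalues are positive, and [T] rescales each eigenvector by the
    inverse square root of its eigenvalue. Applied to a Gram matrix, this orthonormalises a
    basis. *)
Lemma posdef_congruent1 (C : numClosedFieldType) n (G : 'M[C]_n) :
  hermitian G -> (forall v, v != 0 -> 0 < qform G v) ->
  exists2 T : 'M[C]_n, T \in unitmx & T *m G *m T ^t* = 1%:M.
Proof.
move=> hG G0.
have Gn : G \is normalmx by apply/normalmxP; rewrite hG.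
have /orthomx_spectralP := Gn.
set P := spectralmx G; set s := spectral_diag G.
have Pu : P \is unitarymx := spectral_unitarymx G.
rewrite invmx_unitary // => GE.
have PPt : P *m P ^t* = 1%:M by apply/unitarymxP.
have PGP : P *m G *m P ^t* = diag_mx s.
  by rewrite GE !mulmxA PPt mul1mx -mulmxA PPt mulmx1.
have s0 i : 0 < s 0 i.
  have [v Pv] : exists v : 'cV[C]_n, P *m v = delta_mx i 0.
    by exists (P ^t* *m delta_mx i 0); rewrite mulmxA PPt mul1mx.
  have v0 : v != 0.
    apply/eqP => v0; move: Pv; rewrite v0 mulmx0 => /matrixP/(_ i 0).
    by rewrite !mxE !eqxx => /esym/eqP; rewrite oner_eq0.
  have := G0 v v0; rewrite {1}/qform GE !mulmxA -(mulmxA _ P v) Pv.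
  have -> : v ^t* *m P ^t* = delta_mx 0 i.
    by rewrite -map_mxM -trmx_mul Pv trmx_delta map_delta_mx.
  by rewrite -rowE -colE !mxE eqxx mulr1n.
pose r i := (sqrtC (s 0 i))^-1.
have r0 i : 0 <= r i by rewrite invr_ge0 sqrtC_ge0 ltW.
pose T := diag_mx (\row_i r i) *m P.
have TGT : T *m G *m T ^t* = 1%:M.
  have assoc (Y Z : 'M[C]_n) : Y *m P *m G *m (P ^t* *m Z) = Y *m (P *m G *m P ^t*) *m Z.
    by rewrite !mulmxA.
  rewrite /T trmx_mul map_mxM assoc PGP tr_diag_mx map_diag_mx !mulmx_diag.
  apply/matrixP => i j; rewrite !mxE; congr (_ *+ _).
  have rJ : (r i)^* = r i by apply: CrealP; rewrite realE r0.
  have sr0 : sqrtC (s 0 i) != 0 by rewrite sqrtC_eq0 gt_eqF.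
  rewrite /= rJ -[s 0 i]sqrtCK /r expr2.
  by rewrite mulrA mulVf // mul1r mulfV.
exists T => //.
by rewrite -mulmxA in TGT; have [] := mulmx1_unit TGT.
Qed.

Section L2Space.
Context (R : realType) (d : nat) (mu : probability (borelRd R d) R).
Local Notation fct := (borelRd R d -> R[i]).
Local Notation D := (supp mu).

Let mD : measurable D. Proof. exact: measurable_supp. Qed.

Lemma sqr_normcE (z : R[i]) :
  Normc.normc z ^+ 2 = complex.Re z ^+ 2 + complex.Im z ^+ 2.
Proof. by case: z => a b /=; rewrite sqr_sqrtr // addr_ge0 ?sqr_ge0. Qed.

Lemma innerE (u v : fct) : inner mu u v = cE mu D (fun x => u x * (v x)^*).
Proof. by []. Qed.

Lemma in_L2_sqr_integrable (v : fct) : in_L2 mu v ->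
  mu.-integrable D (fun x => (Normc.normc (v x) ^+ 2)%:E).
Proof.
move=> [mr mi voo]; apply/integrableP; split; last first.
  by under eq_integral do rewrite gee0_abs ?lee_fin ?sqr_ge0 //.
apply/measurable_EFinP; under eq_fun do rewrite sqr_normcE.
by apply: measurable_funD; apply: measurable_funX.
Qed.

Lemma in_L2_cint (u v : fct) : in_L2 mu u -> in_L2 mu v ->
  cint mu D (fun x => u x * (v x)^*).
Proof.
move=> uL vL; have [ur ui _] := uL; have [vr vi _] := vL.
have sum_int : mu.-integrable D (fun x =>
    (Normc.normc (u x) ^+ 2)%:E + (Normc.normc (v x) ^+ 2)%:E)%E.
  by apply: integrableD => //; exact: in_L2_sqr_integrable.
(* Real and imaginary parts of [u * conj v] both have the shape [a * c + b * e] up to signs and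
   order, and are thus dominated by [|u|^2 + |v|^2]. *)
have bound (a b c e : R) : `|a * c + b * e| <= a ^+ 2 + b ^+ 2 + (c ^+ 2 + e ^+ 2).
  have := sqr_ge0 (a + c); have := sqr_ge0 (a - c).
  have := sqr_ge0 (b + e); have := sqr_ge0 (b - e).
  by rewrite ler_norml => ? ? ? ?; apply/andP; split; nra.
have int (f : borelRd R d -> R) : measurable_fun D f -> (forall x,
    `|f x| <= Normc.normc (u x) ^+ 2 + Normc.normc (v x) ^+ 2) ->
    mu.-integrable D (EFin \o f).
  move=> mf fB; apply: le_integrable sum_int => //; first exact/measurable_EFinP.
  by move=> x _; rewrite /= lee_fin (le_trans (fB x)) // ler_norm.
split; apply: int.
- have -> : (fun x => complex.Re (u x * (v x)^*)) =
      (fun x => complex.Re (u x) * complex.Re (v x) + complex.Im (u x) * complex.Im (v x)).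
    by apply/funext => x; case: (u x) => a b; case: (v x) => c e /=; rewrite mulrN opprK.
  by apply: measurable_funD; apply: measurable_funM.
- move=> x; rewrite !sqr_normcE; case: (u x) => a b; case: (v x) => c e /=.
  by rewrite mulrN opprK.
- have -> : (fun x => complex.Im (u x * (v x)^*)) =
      (fun x => complex.Im (u x) * complex.Re (v x) - complex.Re (u x) * complex.Im (v x)).
    by apply/funext => x; case: (u x) => a b; case: (v x) => c e /=; rewrite mulrN addrC.
  by apply: measurable_funB; apply: measurable_funM.
- move=> x; rewrite !sqr_normcE; case: (u x) => a b; case: (v x) => c e /=.
  by rewrite (addrC (c ^+ 2)) -(sqrrN e); exact: bound.
Qed.

Lemma innerJ (u v : fct) : in_L2 mu u -> in_L2 mu v ->
  (inner mu u v)^* = inner mu v u.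
Proof.
move=> uL vL; have [ir ii] := in_L2_cint uL vL.
rewrite /inner /=; congr Complex.
  by apply: eq_Rintegral => x _; case: (u x) => a b; case: (v x) => c e /=; ring.
rewrite -mulN1r -RintegralZl //.
by apply: eq_Rintegral => x _; case: (u x) => a b; case: (v x) => c e /=; ring.
Qed.

Lemma inner_lincomb N (b : 'I_N -> fct) (c e : 'I_N -> R[i]) :
  (forall i, in_L2 mu (b i)) ->
  inner mu (lincomb b c) (lincomb b e) =
  \sum_i \sum_j c i * (e j)^* * inner mu (b i) (b j).
Proof.
move=> bL.
transitivity (cE mu D (fun x => \sum_i \sum_j c i * (e j)^* * (b i x * (b j x)^*))).
  apply: eq_cE => x _; rewrite /lincomb big_distrl; apply: eq_bigr => i _ /=.
  rewrite [X in _ * X]rmorph_sum big_distrr; apply: eq_bigr => j _ /=.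
  by rewrite rmorphM mulrACA.
have ib i j : cint mu D (fun x => c i * (e j)^* * (b i x * (b j x)^*)).
  by apply: cintZ => //; exact: in_L2_cint.
rewrite cE_sum //; last by move=> i; exact: cint_sum.
apply: eq_bigr => i _; rewrite cE_sum //; apply: eq_bigr => j _.
by rewrite cEZ //; exact: in_L2_cint.
Qed.

Lemma inner_gt0 (v : fct) : in_L2 mu v ->
  ~ {ae mu, forall x, D x -> v x = 0} -> 0 < inner mu v v.
Proof.
move=> vL nv; have iv := in_L2_sqr_integrable vL.
have E1 x : v x * (v x)^* = (Normc.normc (v x) ^+ 2)%:C%C.
  by rewrite sqr_normcE; case: (v x) => a b /=; simpc; rewrite !expr2 (mulrC b a) addNr.
have -> : inner mu v v = (Rintegral mu D (fun x => Normc.normc (v x) ^+ 2))%:C%C.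
  rewrite innerE (@eq_cE _ _ _ _ _ _ (fun x => (Normc.normc (v x) ^+ 2)%:C%C)); last first.
    by move=> x _; exact: E1.
  by rewrite /cE /= Rintegral_cst // mul0r.
rewrite -[0]/((0 : R)%:C%C) ltcR lt_neqAle Rintegral_ge0 ?andbT; last first.
  by move=> x _; rewrite sqr_ge0.
apply/eqP => i0; apply: nv.
have : (\int[mu]_(x in D) `|(Normc.normc (v x) ^+ 2)%:E| = 0)%E.
  under eq_integral do rewrite gee0_abs ?lee_fin ?sqr_ge0 //.
  by rewrite -[LHS]fineK ?integrable_fin_num // -[fine _]i0.
move/ae_eq_integral_abs => /(_ mD) ae0.
have := ae0 (measurable_int mu iv).
apply: filterS => x /[apply] -[] /eqP; rewrite sqrf_eq0 => /eqP.
exact: Normc.eq0_normc.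
Qed.

(** Linear independence almost everywhere makes the Gram matrix of the given basis positive
    definite; a congruence [T] taking it to the identity yields the orthonormal basis. *)
Lemma exists_orthonormal_basis (V : set fct) (N : nat) :
  L2_subspace_of_dim mu V N -> exists b : 'I_N -> fct, orthonormal_basis mu V b.
Proof.
move=> [VL [b [bV bI]]].
have bE c : V (lincomb b c) by rewrite bV; exists c.
have delta i : lincomb b (fun j => (j == i)%:R) = b i.
  apply/funext => x; rewrite /lincomb (bigD1 i) //= eqxx mul1r big1 ?addr0 // => j ji.
  by rewrite (negbTE ji) mul0r.
have bL i : in_L2 mu (b i) by rewrite -delta; apply: VL.
pose G : 'M[R[i]]_N := \matrix_(i, j) inner mu (b i) (b j).
have hG : hermitian G.
  by apply/matrixP => i j; rewrite !mxE -(innerJ (bL i) (bL j)) conjCK.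
have G0 v : v != 0 -> 0 < qform G v.
  move=> v0.
  (* [qform] conjugates its left argument and [inner] its right one, hence the conjugated
     coefficients. *)
  have -> : qform G v = inner mu (lincomb b (fun i => (v i 0)^*)) (lincomb b (fun i => (v i 0)^*)).
    rewrite inner_lincomb // qform_entries; apply: eq_bigr => i _; apply: eq_bigr => j _.
    by rewrite mxE conjCK.
  apply: inner_gt0; first exact: VL.
  move=> /bI c0; move/eqP: v0; apply; apply/matrixP => i j.
  by rewrite ord1 mxE -[LHS]conjCK c0 rmorph0.
have [T Tu TGT] := posdef_congruent1 hG G0.
pose b' k := lincomb b (fun i => T k i).
exists b'; split; last first.
  move=> k l; rewrite inner_lincomb //.
  have := congr1 (fun A : 'M[R[i]]_N => A k l) TGT; rewrite [RHS]mxE => <-.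
  rewrite [RHS]mxE exchange_big /=; apply: eq_bigr => j _.
  rewrite [X in _ = X * _]mxE mulr_suml; apply: eq_bigr => i _.
  by rewrite !mxE mulrAC.
have b'E c : lincomb b' c = lincomb b (fun i => ((\row_k c k) *m T) 0 i).
  apply/funext => x; rewrite /lincomb /b' /lincomb.
  under eq_bigr do rewrite big_distrr /=.
  rewrite exchange_big /=; apply: eq_bigr => i _.
  by rewrite mxE mulr_suml; apply: eq_bigr => k _; rewrite !mxE mulrA.
rewrite /spanned_by bV; apply/seteqP; split => [_ [c _ <-]|_ [c _ <-]].
  exists (fun k => ((\row_i c i) *m invmx T) 0 k) => //; rewrite b'E.
  congr lincomb; apply/funext => i.
  rewrite (_ : \row_k _ = (\row_i c i) *m invmx T).
    by rewrite mulmxKV // mxE.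
  by apply/rowP => k; rewrite mxE.
by rewrite b'E; exists (fun i => ((\row_k c k) *m T) 0 i).
Qed.

End L2Space.

(** * Sampling inequality at a fixed level *)

Section ChristoffelBasis.
Context (R : realType) (d : nat) (mu : probability (borelRd R d) R).
Local Notation fct := (borelRd R d -> R[i]).
Local Notation D := (supp mu).
Variables (V : set fct) (N : nat).
Hypothesis hV : L2_subspace_of_dim mu V N.
Hypothesis hK : (Kmu mu V N < +oo)%E.
Local Notation K := (fine (Kmu mu V N)).

Let mD : measurable D. Proof. exact: measurable_supp. Qed.

Lemma supp_nonempty : D !=set0.
Proof.
apply/set0P/eqP => D0; have := suppC_null mu; rewrite D0 setC0 probability_setT.
by move=> /eqP; rewrite onee_eq0.
Qed.

(** An orthonormal basis exists, so [xget] in [Kmu] returns the supremum of some such basis rather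
    than the dummy 0; that basis is the one used from here on. *)
Lemma Kmu_basis : exists2 b : 'I_N -> fct, orthonormal_basis mu V b &
  forall x, D x -> \sum_i Normc.normc (b i x) ^+ 2 <= K.
Proof.
have [b0 ob0] := exists_orthonormal_basis hV.
have : (exists2 b : 'I_N -> fct, orthonormal_basis mu V b & Kmu mu V N = ereal_sup
      [set (\sum_(i < N) Normc.normc (b i x) ^+ 2)%:E | x in supp mu]).
  rewrite /Kmu; set S := [set k | _].
  suff [b ob ->] : S (xget 0%E S) by exists b.
  by apply: xgetPex; eexists; exists b0; last by [].
move=> [b ob KE]; exists b => // x Dx.
have le : ((\sum_i Normc.normc (b i x) ^+ 2)%:E <= Kmu mu V N)%E.
  by rewrite KE; apply: ereal_sup_ubound; exists x.
rewrite -lee_fin fineK // fin_numElt hK andbT.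
exact: lt_le_trans (ltNyr _) le.
Qed.

(* The values of [b] off the support are unconstrained, not even measurable:
   they are replaced by 0. *)
Definition basis_vec (b : 'I_N -> fct) (x : borelRd R d) : 'cV[R[i]]_N :=
  \col_k ((fun y => (b k y)^*) \_ D) x.

Lemma basis_vecE b x k : D x -> basis_vec b x k 0 = (b k x)^*.
Proof. by move=> Dx; rewrite mxE patchE mem_set. Qed.

Lemma basis_vec_out b x : ~ D x -> basis_vec b x = 0.
Proof. by move=> nDx; apply/matrixP => i j; rewrite !mxE patchE memNset. Qed.

Lemma normc_normr (z : R[i]) : `|z| ^+ 2 = (Normc.normc z ^+ 2)%:C%C.
Proof. by rewrite rmorphXn. Qed.

Section basis.
Variable b : 'I_N -> fct.
Hypothesis ob : orthonormal_basis mu V b.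
Hypothesis bK : forall x, D x -> \sum_i Normc.normc (b i x) ^+ 2 <= K.

Lemma Kmu_ge0 : 0 <= K.
Proof.
have [x Dx] := supp_nonempty; apply: le_trans (bK Dx).
by rewrite sumr_ge0 // => i _; exact: sqr_ge0.
Qed.

Lemma qform_basis_vec x : qform 1 (basis_vec b x) <= K%:C%C.
Proof.
have [Dx|nDx] := pselect (D x); last first.
  rewrite basis_vec_out // /qform mulmx0 mxE ler0c; exact: Kmu_ge0.
have -> : qform 1 (basis_vec b x) = (\sum_i Normc.normc (b i x) ^+ 2)%:C%C.
  rewrite qform1 rmorph_sum; apply: eq_bigr => i _.
  by rewrite basis_vecE // norm_conjC normc_normr.
by rewrite lecR bK.
Qed.

Lemma basis_vec_lincomb c x : D x ->
  ((basis_vec b x) ^t* *m \col_k c k) 0 0 = lincomb b c x.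
Proof.
move=> Dx; rewrite mxE; apply: eq_bigr => k _.
have -> : ((basis_vec b x) ^t*) 0 k = (basis_vec b x k 0)^* by rewrite !mxE.
by rewrite basis_vecE // conjCK mxE mulrC.
Qed.

Lemma basis_in_L2 k : in_L2 mu (b k).
Proof.
apply: hV.1; rewrite ob.1; exists (fun j => (j == k)%:R) => //.
apply/funext => x; rewrite /lincomb (bigD1 k) //= eqxx mul1r big1 ?addr0 // => j ji.
by rewrite (negbTE ji) mul0r.
Qed.

Lemma basis_normc_le k x : D x -> Normc.normc (b k x) ^+ 2 <= K.
Proof.
move=> Dx; apply: le_trans (bK Dx); rewrite (bigD1 k) //= lerDl.
by rewrite sumr_ge0 // => i _; exact: sqr_ge0.
Qed.

Lemma bmeas_basis_vec k : bmeas (fun x => basis_vec b x k 0).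
Proof.
have [mr mi _] := basis_in_L2 k.
(* From [2 * |a| <= 1 + a ^+ 2], a bound free of square roots. *)
have bnd (a c : R) : a ^+ 2 + c ^+ 2 <= K -> `|a| <= 1 + K.
  move=> acK; have := sqr_ge0 c; have := sqr_ge0 (1 - a); have := sqr_ge0 (1 + a).
  by rewrite ler_norml => ? ? ?; apply/andP; split; nra.
split.
  have -> : (fun x => complex.Re (basis_vec b x k 0)) = (fun x => complex.Re (b k x)) \_ D.
    apply/funext => x; rewrite mxE !patchE; case: ifP => // _.
    by case: (b k x).
  split; first exact: (measurable_restrictT _ mD).1.
  exists (1 + K) => x; rewrite patchE; case: ifPn => [|_]; last first.
    by rewrite normr0 addr_ge0 // Kmu_ge0.
  rewrite inE => Dx; apply: (bnd _ (complex.Im (b k x))).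
  by rewrite -sqr_normcE; exact: basis_normc_le.
have -> : (fun x => complex.Im (basis_vec b x k 0)) = (fun x => - complex.Im (b k x)) \_ D.
  apply/funext => x; rewrite mxE !patchE; case: ifP => // _.
  by case: (b k x).
split; first exact: (measurable_restrictT _ mD).1 (measurable_funN mi).
exists (1 + K) => x; rewrite patchE; case: ifPn => [|_]; last first.
  by rewrite normr0 addr_ge0 // Kmu_ge0.
rewrite inE normrN => Dx; apply: (bnd _ (complex.Re (b k x))).
by rewrite addrC -sqr_normcE; exact: basis_normc_le.
Qed.

Lemma basis_vec_ortho k l :
  cE mu setT (fun x => (basis_vec b x k 0)^* * basis_vec b x l 0) = (k == l)%:R.
Proof.
rewrite -(ob.2 k l) innerE /cE.
have E x : (basis_vec b x k 0)^* * basis_vec b x l 0 =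
    if x \in D then b k x * (b l x)^* else 0.
  rewrite /basis_vec !mxE !patchE; case: ifP => _; last by rewrite mulr0.
  by rewrite conjCK.
by congr Complex; rewrite [RHS]Rintegral_mkcond; apply: eq_Rintegral => x _;
  rewrite E !patchE; case: ifP.
Qed.

(** By orthonormality [N] is the mean of the pointwise sum of the [|b_i|^2], whose supremum bounds
    it. *)
Lemma dim_le_Kmu : N%:R <= K.
Proof.
have bv k : bmeas (fun x => (basis_vec b x k 0)^* * basis_vec b x k 0).
  by apply: bmeasM; [apply: bmeasJ|]; exact: bmeas_basis_vec.
rewrite -lecR -(cE_cst mu K%:C%C).
have -> : (N%:R)%:C%C = cE mu setT (fun x => qform 1 (basis_vec b x)).
  rewrite rmorph_nat; under eq_fun do rewrite qform1.
  have E x : \sum_i `|basis_vec b x i 0| ^+ 2 =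
     \sum_i (basis_vec b x i 0)^* * basis_vec b x i 0.
    by apply: eq_bigr => i _; rewrite normCK mulrC.
  under eq_fun do rewrite E; rewrite cE_sum //; last by move=> i; exact: bmeas_cint.
  rewrite (eq_bigr (fun=> 1)); last by move=> i _; rewrite basis_vec_ortho eqxx.
  by rewrite sumr_const card_ord.
apply: cE_le => //; [|exact: bmeas_cint (bmeas_cst _ _)|by move=> x _; exact: qform_basis_vec].
under eq_fun do rewrite qform_entries.
apply: bmeas_cint; apply: bmeas_sum => i; apply: bmeas_sum => j.
apply: bmeasM; last exact: bmeas_cst.
by apply: bmeasM; [apply: bmeasJ|]; exact: bmeas_basis_vec.
Qed.

End basis.

(** Let [c] be the coordinates of [v]. Cauchy-Schwarz gives [|v(x)|^2 <= K * |c|^2]; off [E] the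
    Chernoff bound gives [M / 6 * |c|^2 <= M * a^2], since the samples of [v] are at most [a] in
    modulus. *)
Lemma sampling_inequality d' (Omega : measurableType d') (P : probability Omega R)
    (M : nat) (X : 'I_M -> Omega -> borelRd R d) :
  (0 < N)%N -> (0 < M)%N -> iid_sample mu P X ->
  N%:R <= K /\
  exists E : set Omega, [/\ measurable E,
    fine (P E) <= N%:R * (1 - (8%:R * K)^-1) ^+ M &
    forall w, ~ E w -> (forall j, D (X j w)) -> forall v, V v ->
      forall x, D x -> forall a, 0 <= a ->
      (forall j, Normc.normc (v (X j w)) <= a) ->
      Normc.normc (v x) ^+ 2 <= 6%:R * K * a ^+ 2].
Proof.
move=> N0 M0 [mX dX iX].
have [b ob bK] := Kmu_basis.
have NK := dim_le_Kmu ob bK; split=> //.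
have K1 : 1 <= K by apply: le_trans NK; rewrite ler1n.
have [E [mE PE EP]] := matrix_chernoff_lower M0 mX dX iX K1 (bmeas_basis_vec ob bK)
   (qform_basis_vec bK) (basis_vec_ortho ob).
exists E; split=> // w nE DX v Vv x Dx a a0.
have [c _ <-] : range (lincomb b) v by rewrite -ob.1.
move=> va.
pose cv : 'cV[R[i]]_N := \col_k c k.
pose q := complex.Re (qform 1 cv).
have qE : qform 1 cv = q%:C%C.
  by rewrite /q RRe_real // realE qform1_ge0.
have q0 : 0 <= q by rewrite -ler0c -qE qform1_ge0.
have vq : Normc.normc (lincomb b c x) ^+ 2 <= K * q.
  rewrite -lecR -normc_normr -(basis_vec_lincomb _ _ Dx) rmorphM /= -qE.
  apply: (le_trans (qform_cauchy_schwarz _ _)).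
  by rewrite ler_wpM2r ?qform1_ge0 // qform_basis_vec.
have : M%:R / 6%:R * q <= M%:R * a ^+ 2.
  rewrite -lecR !rmorphM /= fmorphV !rmorph_nat /= -qE.
  apply: (le_trans (EP w nE cv)).
  rewrite -[M in X in _ <= X]card_ord -sum1_card natr_sum mulr_suml ler_sum // => j _.
  rewrite mul1r (basis_vec_lincomb _ _ (DX j)) normc_normr -rmorphM lecR -expr2.
  by rewrite lerXn2r // ?nnegrE ?sqrtr_ge0 //; case: (lincomb b c _) => ? ?; exact: sqrtr_ge0.
rewrite -mulrA ler_pM2l ?ltr0n // ler_pdivrMl // => qa.
apply: (le_trans vq); rewrite -mulrA mulrCA ler_wpM2l //.
exact: le_trans K1.
Qed.

End ChristoffelBasis.

(** * Passage to the limit *)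

Lemma limn_esup_lt_eventually (R : realType) (u : nat -> \bar R) (l : \bar R) :
  (limn_esup u < l)%E -> exists n0, forall n, (n0 <= n)%N -> (u n < l)%E.
Proof.
rewrite /limn_esup limf_esupE => /ereal_inf_lt[_ [A [n0 _ An0] <-] supl].
exists n0 => n n0n; apply: le_lt_trans supl; apply: ereal_sup_ubound.
by exists n => //; exact: An0.
Qed.

Lemma limn_esup_ge (R : realType) (u : nat -> \bar R) (c : \bar R) n0 :
  (forall n, (n0 <= n)%N -> (c <= u n)%E) -> (c <= limn_esup u)%E.
Proof.
move=> cu; rewrite leNgt; apply/negP => /limn_esup_lt_eventually[n1 uc].
have := uc (maxn n0 n1) (leq_maxr _ _).
by rewrite ltNge cu // leq_maxl.
Qed.

Lemma sum_inv_sqr_lty (R : realType) (u : nat -> \bar R) :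
  (forall n, (0 <= u n)%E) -> (forall n, (u n <= ((n.+1%:R ^+ 2)^-1)%:E)%E) ->
  (\sum_(n <oo) u n < +oo)%E.
Proof.
move=> u0 uB; apply: (@le_lt_trans _ _ (2%:R)%:E); last exact: ltry.
apply: lime_le; first by apply: is_cvg_nneseries => n _ _.
apply: nearW => n.
(* This closed-form majorant of the partial sums is sharp enough for induction: its increment is
   [2 / ((n+1) * (n+2))], at least [1 / (n+1)^2]. *)
suff : (\sum_(0 <= i < n) u i <= (2%:R * (1 - n.+1%:R^-1))%:E)%E.
  move=> /le_trans; apply; rewrite lee_fin ler_piMr // gerBl invr_ge0 //.
elim: n => [|n IH]; first by rewrite big_geq // invr1 subrr mulr0.
rewrite big_nat_recr //=; apply: (le_trans (leeD IH (uB n))).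
rewrite -EFinD lee_fin -subr_ge0.
have n1 : n.+1%:R != 0 :> R by rewrite pnatr_eq0.
have n2 : n.+2%:R != 0 :> R by rewrite pnatr_eq0.
have E2 : n.+2%:R = n.+1%:R + 1 :> R by rewrite -natr1.
rewrite (_ : _ - _ = n%:R / (n.+1%:R ^+ 2 * n.+2%:R)).
  by rewrite divr_ge0 // mulr_ge0.
have E1 : n%:R = n.+1%:R - 1 :> R by rewrite -natr1 addrK.
rewrite {IH uB u0} E1 E2; rewrite E2 in n2; move: (n.+1%:R) n1 n2 => y y0 y1.
by field; rewrite y0 y1.
Qed.

Lemma powRE (R : realType) (a x : R) : 0 < a -> a `^ x = expR (x * ln a).
Proof. by move=> a0; rewrite /powR gt_eqF. Qed.

(** From [1 - x <= exp (- x)], the power is at most [exp (- M / (8 * K))], and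
    [M / (8 * K) >= 25/8 * ln N >= 3 * ln N]; the factor [N] leaves [N^-2]. *)
Lemma chernoff_rate (R : realType) (N M : nat) (q K : R) :
  (0 < N)%N -> 1 <= q -> 1 <= K -> 25%:R * q * K * ln N%:R <= M%:R ->
  N%:R * (1 - (8%:R * K)^-1) ^+ M <= (N%:R ^+ 2)^-1.
Proof.
move=> N0 q1 K1 MK; have Np : 0 < N%:R :> R by rewrite ltr0n.
have K0 : 0 < K by apply: lt_le_trans K1.
have lnN : 0 <= ln N%:R :> R by rewrite ln_ge0 // ler1n.
have h8 : 0 <= 1 - (8%:R * K)^-1.
  rewrite subr_ge0 invf_le1 ?mulr_gt0 // mulr_ege1 // ler1n //.
have le : (1 - (8%:R * K)^-1) ^+ M <= expR (- (3%:R * ln N%:R)).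
  apply: (@le_trans _ _ (expR (- (8%:R * K)^-1) ^+ M)).
    by rewrite lerXn2r // ?nnegrE ?expR_ge0 // expR_ge1Dx.
  rewrite -expRM_natr ler_expR mulNr lerN2.
  rewrite ler_pdivlMl ?mulr_gt0 //; apply: le_trans MK.
  have qK : K * ln N%:R <= q * (K * ln N%:R).
    by rewrite ler_peMl // mulr_ge0 // ltW.
  have K2 : 0 <= K * ln N%:R by rewrite mulr_ge0 // ltW.
  rewrite (_ : 8%:R * K * _ = 24%:R * (K * ln N%:R)); last by ring.
  by rewrite (_ : 25%:R * _ * _ * _ = 25%:R * (q * (K * ln N%:R))); [lra|ring].
apply: (le_trans (ler_wpM2l (ltW Np) le)).
rewrite expRN expRM_natl lnK ?posrE // exprS invfM mulrA mulfV ?gt_eqF // mul1r //.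
Qed.

Theorem theorem4p4 (R : realType) (d : nat)
  (mu : probability (borelRd R d) R)
  (V : nat -> set (borelRd R d -> R[i])) (N : nat -> nat)
  (hV : forall n, L2_subspace_of_dim mu (V n) (N n))
  (hN : forall n, (1 <= N n)%N)
  (hVS : forall n, V n `<=` V n.+1)
  (hNS : forall n, (N n < N n.+1)%N)
  (hK : forall n, (Kmu mu (V n) (N n) < +oo)%E)
  (hq : (qstar mu V N < +oo)%E)
  (d' : measure_display) (Omega : measurableType d') (P : probability Omega R)
  (M : nat -> nat)
  (hM : forall n, (M n)%:Z =
    Num.ceil (25%:R * fine (qstar mu V N) *
              fine (Kmu mu (V n) (N n)) * ln (N n)%:R))
  (X : forall n, 'I_(M n) -> Omega -> borelRd R d)
  (hX : forall n, iid_sample mu P (X n)) :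
  {ae P, forall w, forall tau : R, 0 < tau ->
    asymptotic_WAM mu V N (fun n => sample_set (X n) w)
      (fine (qstar mu V N) + tau) (fine (qstar mu V N) / 2%:R + tau)}.
Proof.
set q := fine (qstar mu V N).
pose K n := fine (Kmu mu (V n) (N n)).
(* This turns the rate [N^-2] into the summable [(n+1)^-2], and makes [ln (N n)] positive for
   [n > 0]. *)
have Nn n : (n < N n)%N by elim: n => [|n IH]; [exact: hN|exact: leq_ltn_trans IH (hNS n)].
have NK n : (N n)%:R <= K n.
  by have [b ob bK] := Kmu_basis (hV n) (hK n); exact: dim_le_Kmu ob bK.
have N0 n : 0 < (N n)%:R :> R by rewrite ltr0n.
have K1 n : 1 <= K n by apply: le_trans (NK n); rewrite ler1n.
have K0 n : 0 < K n by apply: lt_le_trans (K1 n).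
have lnN_gt0 n : (0 < n)%N -> 0 < ln (N n)%:R :> R.
  by move=> n0; rewrite ln_gt0 // ltr1n (leq_ltn_trans n0).
(* As [K n >= N n], every quotient with [n >= 1] is at least 1. This also makes [qstar] a finite
   number, so that [fine] is faithful. *)
have q1 : (1%:E <= qstar mu V N)%E.
  apply: (@limn_esup_ge _ _ _ 1) => n n0.
  rewrite lee_fin ler_pdivlMr ?lnN_gt0 // mul1r.
  by rewrite ler_ln ?posrE ?NK ?N0 // K0.
have qE : qstar mu V N = q%:E.
  by rewrite fineK // fin_numElt hq andbT; exact: lt_le_trans (ltNyr _) q1.
rewrite qE lee_fin in q1.
have q0 : 0 < q by apply: lt_le_trans q1.
have MK n : 25%:R * q * K n * ln (N n)%:R <= (M n)%:R.
  by rewrite -[(M n)%:R]/((M n)%:Z%:~R) hM; exact: ceil_ge.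
have MKlt n : (M n)%:R <= 25%:R * q * K n * ln (N n)%:R + 1.
  rewrite -lerBlDr -[(M n)%:R]/((M n)%:Z%:~R) -[1 in X in X <= _]/(1%:~R) -rmorphB hM.
  exact: ltW (ceilB1_lt _).
have levels n : exists E : set Omega, [/\ measurable E,
    (P E <= ((n.+1%:R ^+ 2)^-1)%:E)%E &
    forall w, (0 < n)%N -> ~ E w -> (forall j, supp mu (X n j w)) ->
    forall v, V n v -> forall x, supp mu x -> forall a, 0 <= a ->
      (forall j, Normc.normc (v (X n j w)) <= a) ->
      Normc.normc (v x) ^+ 2 <= 6%:R * K n * a ^+ 2].
  have [->|n0] := posnP n.
    (* [M 0] may be 0, as [N 0 = 1] is possible; the bound at 0 is trivial. *)
    by exists setT; split=> //; rewrite probability_setT expr1n invr1.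
  have M0 : (0 < M n)%N.
    by rewrite -(ltr0n R); apply: lt_le_trans (MK n); rewrite !mulr_gt0 // lnN_gt0.
  have [_ [E [mE PE EP]]] := sampling_inequality (hV n) (hK n) (hN n) M0 (hX n).
  exists E; split=> //; last by move=> w _; exact: EP.
  rewrite -[P E]fineK ?fin_num_measure // lee_fin (le_trans PE) //.
  apply: (le_trans (chernoff_rate (hN n) q1 (K1 n) (MK n))).
  by rewrite lef_pV2 ?posrE ?exprn_gt0 // lerXn2r ?nnegrE // ler_nat.
have [E EP] := choice levels.
(* Borel-Cantelli. *)
have limE : P (lim_sup_set E) = 0%E.
  apply: lim_sup_set_cvg0 => [k|]; first by have [] := EP k.
  by apply: sum_inv_sqr_lty => // n; have [] := EP n.
(* The event that sample [k] of level [n] misses the support. Through [insub], [k] ranges over all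
   naturals, with the empty event beyond [M n], so that a countable union covers every level. *)
pose out n k : set Omega :=
  if insub k is Some j then X n j @^-1` (~` supp mu) else set0.
have out0 : P.-negligible (\bigcup_n \bigcup_k out n k).
  apply: negligible_bigcup => n; apply: negligible_bigcup => k.
  rewrite /out; case: insub => [j|]; last exact: negligible_set0.
  have [mX dX _] := hX n.
  have mC : measurable (~` supp mu) by apply: measurableC; exact: measurable_supp.
  exists (X n j @^-1` (~` supp mu)); split => //.
    by rewrite -[X in measurable X]setTI; exact: mX.
  exact: etrans (dX j _ mC) (suppC_null mu).
have limE0 : P.-negligible (lim_sup_set E).
  exists (lim_sup_set E); split => //.
  apply: bigcap_measurable => // k _; apply: bigcup_measurable => i _.
  by have [] := EP i.
(* The exceptional set is fixed before [tau] is introduced, so one null set serves all [tau]. *)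
apply: negligibleS (negligibleU limE0 out0) => w.
apply: contra_notP => /not_orP[nlim nout] tau tau0.
have sX n j : supp mu (X n j w).
  apply: contrapT => nS; apply: nout; exists n => //; exists (val j) => //.
  by rewrite /out valK.
have [n1 nE] : exists n1, forall n, (n1 <= n)%N -> ~ E n w.
  apply: contrapT => nn; apply: nlim => n1 _; apply: contrapT => nU; apply: nn.
  by exists n1 => n n1n En; apply: nU; exists n.
have Kpow eps : 0 < eps -> exists n2, forall n, (n2 <= n)%N -> (0 < n)%N ->
    K n <= (N n)%:R `^ (q + eps).
  move=> eps0; have : (qstar mu V N < (q + eps)%:E)%E by rewrite qE lte_fin ltrDl.
  move=> /limn_esup_lt_eventually[n2 n2P]; exists n2 => n n2n n0.
  have := n2P n n2n; rewrite lte_fin ltr_pdivrMr ?lnN_gt0 // => /ltW lnK_le.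
  by rewrite powRE // -[leLHS]lnK ?posrE // ler_expR.
(* Exponent [q + 2 * tau] becomes [b = q / 2 + tau] under the square root. For the cardinality,
   [tau / 2] is spent on [K] and the other [tau / 2] on the logarithm. *)
have [n2 n2P] := Kpow (2%:R * tau) (mulr_gt0 (ltr0Sn _ 1) tau0).
have [n3 n3P] := Kpow (tau / 2%:R) (divr_gt0 tau0 (ltr0Sn _ 1)).
split.
  by move=> n x /imfsetP[j _ ->]; exact: sX.
(* In [ka], [2 / tau] comes from [ln N <= (2 / tau) * N^(tau/2)] and [+ 1] from the ceiling in
   [M n]; [kb] is the root of the 6 in the sampling inequality. *)
exists (maxn 1 (maxn n1 (maxn n2 n3))), (25%:R * q * (2%:R / tau) + 1), (Num.sqrt 6%:R).
move=> n; rewrite !geq_max => /and4P[n0 n1n n2n n3n]; split.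
  move=> v Vv; set a := \big[_/_]_(_ <- _) _.
  have a0 : 0 <= a by rewrite /a; elim/big_rec: _ => // x y _ y0; rewrite le_max y0 orbT.
  have va j : Normc.normc (v (X n j w)) <= a.
    apply: (@le_bigmax_seq _ _ _ _ _ (X n j w : 'rV[R]_d) predT
      (fun x => Normc.normc (v x))) => //.
    exact: in_imfset.
  have [_ _ Ew] := EP n.
  apply: ge_ereal_sup => _ [x Dx <-]; rewrite lee_fin.
  have vx := Ew w n0 (nE n n1n) (sX n) v Vv x Dx a a0 va.
  have normc_ge0 (z : R[i]) : 0 <= Normc.normc z by case: z => ? ?; exact: sqrtr_ge0.
  rewrite -(@ler_pXn2r _ 2) ?nnegrE ?normc_ge0 ?mulr_ge0 ?sqrtr_ge0 ?powR_ge0 //.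
  apply: (le_trans vx); rewrite !exprMn sqr_sqrtr // ler_wpM2r ?sqr_ge0 //.
  rewrite ler_wpM2l // (le_trans (n2P n n2n n0)) // !powRE // -expRM_natl ler_expR.
  by rewrite le_eqVlt; apply/orP; left; apply/eqP; field.
apply: (@le_trans _ _ (M n)%:R).
  by rewrite ler_nat (leq_trans (leq_imfset_card _ _ _)) // size_enum_ord.
apply: (le_trans (MKlt n)).
set L := ln (N n)%:R in lnN_gt0 MKlt MK *.
have L0 : 0 <= L by rewrite ln_ge0 // ler1n.
have KE := n3P n n3n n0.
rewrite powRE // -/L in KE; rewrite powRE // -/L.
(* The inequality [y <= exp y] at [y = tau / 2 * L]. *)
have LE : L <= 2%:R / tau * expR (tau / 2%:R * L).
  have := expR_ge1Dx (tau / 2%:R * L); move: (expR _) => y yL.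
  have t0 : tau != 0 by rewrite gt_eqF.
  rewrite [leLHS](_ : _ = 2%:R / tau * (tau / 2%:R * L)); last by field.
  by rewrite ler_wpM2l ?divr_ge0 ?(ltW tau0) // (le_trans _ yL) // lerDr.
have KL : K n * L <= 2%:R / tau * expR ((q + tau) * L).
  apply: (le_trans (ler_pM (ltW (K0 n)) L0 KE LE)).
  rewrite mulrCA -expRD ler_wpM2l ?divr_ge0 ?(ltW tau0) // ler_expR.
  by rewrite le_eqVlt; apply/orP; left; apply/eqP; field.
rewrite (mulrDl _ 1) mul1r lerD //.
  by rewrite -!mulrA ler_wpM2l // ler_wpM2l ?(ltW q0) // mulrA.
apply: le_trans (expR_ge1Dx _); rewrite lerDl mulr_ge0 // addr_ge0 ?(ltW q0) ?(ltW tau0) //.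
Qed.
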